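(* Let $n\ge1$ and let $h=(s,p)$ be a rational $\Gamma$-inner function of type $(n,k)$ having distinct royal nodes $\sigma_1,\dots,\sigma_n$ and corresponding royal values $\eta_1,\dots,\eta_n$, where $\sigma_1,\dots,\sigma_k\in\mathbb T$. Let $\rho_j=\tfrac12 Ap(\sigma_j)$ for $j=1,\dots,k$. (1) There exists a rational inner function $\varphi$ that solves the Blaschke interpolation problem with data $(\sigma,\eta,\rho)$, that is, such that $\deg(\varphi)=n$, $\varphi(\sigma_j)=\eta_j$ for $j=1,\dots,n$ and $A\varphi(\sigma_j)=\rho_j$ for $j=1,\dots,k$. Any such function $\varphi$ is expressible in the form $\varphi=\Phi_\omega\circ h$ for some $\omega\in\mathbb T$. (2) There exist polynomials $a,b,c,d$ of degree at most $n$ such that a normalised linear fractional parametrization of the solutions of this Blaschke interpolation problem is $$\varphi=\frac{a\zeta+b}{c\zeta+d},\qquad \zeta\in\mathbb T.$$ (3) For any polynomials $a,b,c,d$ as in (2), there exist $s_0,p_0\in\mathbb C$ such that $$|p_0|=1,\qquad s_0=\overline{s_0}\,p_0,\qquad |s_0|<2,\qquad |c|\le|d|\ \text{ on }\mathbb D,$$ $$s_0a-2b+2p_0c-s_0d=0$$ and (as polynomials, i.e. not identically equal) $$(2p_0c-s_0d)^2\ne(-2p_0a+s_0b)(s_0c-2d).$$ Moreover (for these $s_0,p_0$) $$s=2\,\frac{2p_0c-s_0d}{s_0c-2d},\qquad p=\frac{-2p_0a+s_0b}{s_0c-2d}.$$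
   Context: $\mathbb D$ is the open unit disc, $\mathbb D^-$ its closure, $\mathbb T$ the unit circle. Phasar derivative: for differentiable $f:\mathbb T\to\mathbb C\setminus\{0\}$, $Af(e^{i\theta})=\frac{d}{d\theta}\arg f(e^{i\theta})$; for a rational inner function $\varphi$, $A\varphi(z)=z\varphi'(z)/\varphi(z)$ on $\mathbb T$. A rational inner function is the same as a finite Blaschke product. $\Gamma=\{(z+w,zw):|z|\le1,|w|\le1\}\subset\mathbb C^2$, with distinguished boundary $b\Gamma=\{(z+w,zw):|z|=|w|=1\}$. A $\Gamma$-inner function is a holomorphic map $h:\mathbb D\to\Gamma$ whose boundary values at almost all points of $\mathbb T$ lie in $b\Gamma$; it is rational if its two components are. The royal variety is $\mathcal R=\{(2z,z^2):z\in\mathbb C\}$. Let $h=(s,p)$ be a rational $\Gamma$-inner function with $h(\mathbb D)\not\subset\mathcal R$. A royal node of $h$ is a point $\sigma\in\mathbb D^-$ with $h(\sigma)\in\mathcal R$, i.e. a zero of $s^2-4p$ in $\mathbb D^-$; if $h(\sigma)=(-2\eta,\eta^2)$ then $\eta\in\mathbb D^-$ is the corresponding royal value. If $\sigma$ is a zero of $s^2-4p$ of order $\ell$, the multiplicity of the royal node $\sigma$ is $\ell$ if $\sigma\in\mathbb D$ and $\ell/2$ if $\sigma\in\mathbb T$. $h$ has type $(n,k)$ if the multiplicities of its royal nodes in $\mathbb D^-$ sum to $n$ and those of its royal nodes in $\mathbb T$ sum to $k$ (it is known that $p$ is then a Blaschke product of degree $n$). Blaschke interpolation problem with data $(\sigma,\eta,\rho)$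 (where $\sigma_j,\eta_j\in\mathbb T$ for $j\le k$, $\sigma_j,\eta_j\in\mathbb D$ for $k<j\le n$, $\rho_j>0$ for $j\le k$): find a rational inner function $\varphi$ of degree exactly $n$ such that $\varphi(\sigma_j)=\eta_j$ for $j\le n$ and $A\varphi(\sigma_j)=\rho_j$ for $j\le k$. Normalised linear fractional parametrization of the solutions of such a problem: an expression $\varphi=\frac{a\zeta+b}{c\zeta+d}$ such that (1) $a,b,c,d$ are polynomials of degree at most $n$; (2) for all but at most $k$ values of $\zeta\in\mathbb T$ the function $\varphi(\lambda)=\frac{a(\lambda)\zeta+b(\lambda)}{c(\lambda)\zeta+d(\lambda)}$ is a solution of the problem; (3) for some $\tau\in\mathbb T\setminus\{\sigma_1,\dots,\sigma_k\}$, $a(\tau)=d(\tau)=1$ and $b(\tau)=c(\tau)=0$; (4) every solution has the form in (2) for some $\zeta\in\mathbb T$. For $\omega\in\mathbb T$, $\Phi_\omega(s,p)=\frac{2\omega p-s}{2-\omega s}$. *)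

(* Defs.v *)
From HB Require Import structures.
From mathcomp Require Import all_boot all_order all_algebra.
From mathcomp Require Import complex.
From mathcomp Require Import all_classical all_reals all_analysis.

Set Implicit Arguments.
Unset Strict Implicit.
Unset Printing Implicit Defensive.

Import Order.TTheory GRing.Theory Num.Theory.
Import numFieldNormedType.Exports.

Local Open Scope classical_set_scope.
Local Open Scope complex_scope.
Local Open Scope ring_scope.

Notation "x %:F" := (@FracField.tofrac _ x) : ring_scope.

(* A rational function is an element of the field of fractions of {poly F}.
   The representative [repr f] need not have coprime
   numerator and denominator, so values, degrees and
   orders of zeros are read off the fraction in lowest terms. *)
Section RationalFunctions.
Variable F : fieldType.
Implicit Type f : {fraction {poly F}}.

Definition rnum f : {poly F} :=
  (frac (repr f)).1 %/ gcdp (frac (repr f)).1 (frac (repr f)).2.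

Definition rden f : {poly F} :=
  (frac (repr f)).2 %/ gcdp (frac (repr f)).1 (frac (repr f)).2.

Definition reval f (z : F) : F := (rnum f).[z] / (rden f).[z].

Definition rdegree f : nat := (maxn (size (rnum f)) (size (rden f))).-1.

Definition zero_order f (z : F) : nat := mup z (rnum f).

Lemma rden_neq0 f : rden f != 0.
Proof.
by rewrite dvdp_div_eq0 ?dvdp_gcdr // denom_ratioP.
Qed.

Lemma coprimep_rnum_rden f : coprimep (rnum f) (rden f).
Proof. by apply: coprimep_div_gcd; rewrite denom_ratioP orbT. Qed.

Lemma rnum_rdenE f : f = (rnum f)%:F / (rden f)%:F.
Proof.
have d0 : (frac (repr f)).2 != 0 by apply: denom_ratioP.
have fE : f * ((frac (repr f)).2)%:F = ((frac (repr f)).1)%:F.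
  rewrite -{1}(reprK f) -[repr f in LHS]Ratio_numden.
  rewrite !piE; apply/eqP; rewrite FracField.equivf_def /FracField.equivf.
  rewrite /FracField.mulf !numden_Ratio ?mulr1 ?oner_neq0 ?mulf_neq0 //.
  by rewrite ?mulr1 mulrC.
have g0 : (gcdp (frac (repr f)).1 (frac (repr f)).2)%:F != 0 :> {fraction {poly F}}.
  by rewrite tofrac_eq0 gcdp_eq0 negb_and d0 orbT.
have r0 : (rden f)%:F != 0 :> {fraction {poly F}}.
  by rewrite tofrac_eq0 rden_neq0.
apply: (mulIf r0); apply: (mulIf g0); rewrite mulfVK //.
rewrite -mulrA -tofracM [_ * gcdp _ _]divpK ?dvdp_gcdr // fE.
by rewrite -tofracM divpK ?dvdp_gcdl.
Qed.

End RationalFunctions.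

Section GammaInner.
Variable R : realType.
Local Notation C := R[i].
Implicit Types (f : C -> C) (z : C) (s p phi : {fraction {poly C}}).

Definition disc : set C := [set z | `|z| < 1].
Definition closed_disc : set C := [set z | `|z| <= 1].
Definition circle : set C := [set z | `|z| = 1].

(* [C^o] carries the norm topology and the complex normed-module structure, so
   that [derivable] and [derive1] are complex differentiability and the complex
   derivative. *)
Definition holomorphic_disc f : Prop :=
  forall z, disc z -> derivable (f : C^o -> C^o) z 1.

Definition expi (t : R) : C := cos t +i* sin t.

Definition radial_limit f z (l : C) : Prop :=
  (fun r : R => f (r%:C * z) : C^o) @ 1^'- --> (l : C^o).

Definition inner f : Prop :=
  [/\ holomorphic_disc f,
      forall z, disc z -> closed_disc (f z) &
      {ae lebesgue_measure, forall t : R,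
         exists2 l, radial_limit f (expi t) l & circle l}].

Definition Gamma : set (C * C) :=
  [set x | exists z w, [/\ closed_disc z, closed_disc w & x = (z + w, z * w)]].

Definition bGamma : set (C * C) :=
  [set x | exists z w, [/\ circle z, circle w & x = (z + w, z * w)]].

Definition royal_variety : set (C * C) :=
  [set x | exists z, x = (2 * z, z ^+ 2)].

Definition Gamma_inner (f g : C -> C) : Prop :=
  [/\ holomorphic_disc f, holomorphic_disc g,
      forall z, disc z -> Gamma (f z, g z) &
      {ae lebesgue_measure, forall t : R, exists l m,
         [/\ radial_limit f (expi t) l, radial_limit g (expi t) m &
             bGamma (l, m)]}].

(* [reval] sends poles to 0, where the function is then not differentiable;
   so holomorphy excludes poles in the disc. *)
Definition rational_inner phi : Prop := inner (reval phi).

Definition rational_Gamma_inner s p : Prop := Gamma_inner (reval s) (reval p).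

Definition phasar_derivative phi z : C :=
  z * derive1 (reval phi : C^o -> C^o) z / reval phi z.

Definition royal_nodes s p : set C :=
  [set z | closed_disc z /\ royal_variety (reval s z, reval p z)].

Definition royal_multiplicity s p z : rat :=
  let l := zero_order (s ^+ 2 - 4 * p) z in
  if `|z| == 1 then l%:R / 2 else l%:R.

(* The sums are over finite sets as soon as [s ^+ 2 - 4 * p != 0]. *)
Definition has_type (n k : nat) s p : Prop :=
  \sum_(z \in royal_nodes s p) royal_multiplicity s p z = n%:R /\
  \sum_(z \in royal_nodes s p `&` circle) royal_multiplicity s p z = k%:R.

(* Indices are 0-based: the boundary nodes are those with [j < k], and [rho j]
   is relevant for these only. [0 < rho j] in [C] says that [rho j] is real and
   positive. *)
Definition Blaschke_data (n k : nat) (sigma eta rho : 'I_n -> C) : Prop :=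
  [/\ forall j : 'I_n, (j < k)%N -> circle (sigma j) /\ circle (eta j),
      forall j : 'I_n, (k <= j)%N -> disc (sigma j) /\ disc (eta j) &
      forall j : 'I_n, (j < k)%N -> 0 < rho j].

Definition Blaschke_solution (n k : nat) (sigma eta rho : 'I_n -> C) phi :
    Prop :=
  [/\ rational_inner phi, rdegree phi = n,
      forall j, reval phi (sigma j) = eta j &
      forall j : 'I_n, (j < k)%N -> phasar_derivative phi (sigma j) = rho j].

Definition lft (a b c d : {poly C}) (zeta : C) : {fraction {poly C}} :=
  (zeta *: a + b)%:F / (zeta *: c + d)%:F.

Definition normalised_parametrization (n k : nat)
    (sigma eta rho : 'I_n -> C) (a b c d : {poly C}) : Prop :=
  [/\ [/\ (size a <= n.+1)%N, (size b <= n.+1)%N, (size c <= n.+1)%N &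
          (size d <= n.+1)%N],
      exists2 E : seq C, (size E <= k)%N &
        forall zeta, circle zeta -> zeta \notin E ->
          Blaschke_solution k sigma eta rho (lft a b c d zeta),
      exists tau, [/\ circle tau,
        forall j : 'I_n, (j < k)%N -> tau != sigma j,
        a.[tau] = 1 /\ d.[tau] = 1 & b.[tau] = 0 /\ c.[tau] = 0] &
      forall phi, Blaschke_solution k sigma eta rho phi ->
        exists2 zeta, circle zeta & phi = lft a b c d zeta].

Definition Phi (omega : C) (x : C * C) : C :=
  (2 * omega * x.2 - x.1) / (2 - omega * x.1).

End GammaInner.

(* Main.v *)
Require Import Defs.
From mathcomp Require Import all_boot all_order all_algebra.
From mathcomp Require Import complex.
From mathcomp Require Import all_classical all_reals all_analysis.
From mathcomp Require Import ring lra zify.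

Set Implicit Arguments.
Unset Strict Implicit.
Unset Printing Implicit Defensive.

Import Order.TTheory GRing.Theory Num.Theory.
Import numFieldNormedType.Exports.

Local Open Scope classical_set_scope.
Local Open Scope complex_scope.
Local Open Scope ring_scope.

(** Write [h = (s, p)].  A rational Gamma-inner function has the form
    [s = E / D], [p = D~ / D], where [D] has no zero in the closed disc, [~] is
    reversal of conjugated coefficients with respect to the degree [N] of [p],
    and [E~ = E] ([Gamma_fractionP]).  The royal polynomial [E^2 - 4 D D~] is the
    numerator of [s^2 - 4 p].  On the circle it equals [z^N] times
    [|E|^2 - 4 |D|^2 <= 0], so its zeros there are at least double
    ([royal_poly_double]), and every royal node has multiplicity at least 1.
    Since the type is [(n, k)], the [n] given nodes are all the royal nodes, they
    are simple, and exactly the first [k] lie on the circle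
    ([royal_nodes_simple]).  The royal polynomial is equal to its own reversal
    and so, by symmetry in the circle, it is a constant multiple of
    [prod_j (z - sigma_j)(1 - conj(sigma_j) z)]; comparing degrees gives [N = n]
    ([royal_degree]).

    For [w] on the circle, [Phi_w o h = (2 w D~ - E) / (2 D - w E)].  The numerator
    is [w] times the reversal of the denominator, and the denominator can vanish
    in the closed disc only where [|s| = 2], which means at a boundary node with
    [1 + w eta_j = 0].  For every other [w] the quotient is therefore a Blaschke
    product of degree [n].  It takes the value [eta_j] at [sigma_j] because
    [s = -2 eta_j] and [p = eta_j^2] there; its phasar derivative is half that of
    [p] because the double zero of [s^2 - 4 p] ties [s'] to [p']
    ([derivE_sigma], [Phi_solution]).

    Conversely, let [phi = Q~ / Q] be a solution and consider
    [w = (2 phi + s) / (2 p + phi s)], the only candidate for [phi = Phi_w o h].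
    Its numerator [F = 2 Q~ D + E Q] and its denominator [F~] vanish at all nodes,
    doubly at those of the circle, thanks to the interpolation conditions.  Hence
    both are divisible by the degree [2 n] product above; the quotients are
    conjugate to each other on the circle, which forces them to be constants.
    So [w] is a unimodular constant ([solution_Phi], [solutionP]).

    The solutions are thus the functions [Phi_w o h].  With [s0 = s(tau)],
    [p0 = p(tau)] and [zeta = phi(tau)] one has
    [w = (2 zeta + s0) / (2 p0 + zeta s0)]; substituting this in [Phi_w o h] yields
    [a], [b], [c], [d] explicitly ([par_normalised]).  Any other parametrization
    normalised at [tau] coincides with this one, since lowest terms are unique up
    to a constant and the normalisation fixes the constant ([normalised_par]);
    the last claims are then identities about explicit polynomials
    ([par_conclusion]). *)

(** * Conjugate reversal of polynomials *)

Section Reversal.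
Variable C : numClosedFieldType.
Implicit Types (p q : {poly C}) (z : C) (N : nat).

(** The polynomial [z^N * conj (q (1 / conj z))].  The bound [N] is an argument,
    because the degree of [q] may be smaller. *)
Definition crev N q : {poly C} := \poly_(i < N.+1) (q`_(N - i))^*.

Lemma circle_neq0 z : `|z| = 1 -> z != 0.
Proof. by move=> z1; rewrite -normr_gt0 z1 ltr01. Qed.

Lemma circle_conj z : `|z| = 1 -> z^* = z^-1.
Proof.
move=> z1; have z0 := circle_neq0 z1.
by apply: (mulfI z0); rewrite -normCK z1 expr1n mulfV.
Qed.

Lemma size_crev N q : (size (crev N q) <= N.+1)%N.
Proof. exact: size_poly. Qed.

Lemma horner_crev N q z : (size q <= N.+1)%N -> z != 0 ->
  (crev N q).[z] = z ^+ N * (q.[(z^*)^-1])^*.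
Proof.
move=> sq z0; rewrite horner_poly (horner_coef_wide _ sq) rmorph_sum mulr_sumr.
rewrite (reindex_inj rev_ord_inj) /=; apply: eq_bigr => i _.
have iN : (i <= N)%N by rewrite -ltnS.
rewrite subSS subKn // rmorphM /= mulrCA; congr (_ * _).
have -> : ((z^*)^-1 ^+ i)^* = z ^- i by rewrite rmorphXn /= fmorphV /= conjCK exprVn.
by rewrite -expfB_cond // (negPf z0) add0n.
Qed.

Lemma crev_circle N q z : (size q <= N.+1)%N -> `|z| = 1 ->
  (crev N q).[z] = z ^+ N * (q.[z])^*.
Proof.
move=> sq z1; rewrite horner_crev ?circle_neq0 //.
by rewrite (circle_conj z1) invrK.
Qed.

Lemma crevK N q : (size q <= N.+1)%N -> crev N (crev N q) = q.
Proof.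
move=> sq; apply/polyP => i; rewrite !coef_poly !ltnS leq_subr.
case: (leqP i N) => iN; last by rewrite nth_default //; exact: leq_trans sq iN.
by rewrite subKn // conjCK.
Qed.

(** Witnesses are the Cayley transforms of the natural numbers. *)
Lemma circle_infinite (s : seq C) : exists2 z, `|z| = 1 & z \notin s.
Proof.
pose u (k : nat) : C := (1 + 'i * k%:R) / (1 - 'i * k%:R).
have kr k : k%:R \is @Num.real C by rewrite realn.
have conju k : (1 + 'i * k%:R : C)^* = 1 - 'i * k%:R.
  by rewrite rmorphD rmorph1 rmorphM /= conjCi conjC_nat mulNr.
have dn0 k : (1 - 'i * k%:R : C) != 0.
  apply/eqP => /subr0_eq /(congr1 (fun x => x ^+ 2)) /eqP.
  rewrite expr1n exprMn sqrCi mulN1r -subr_eq0 opprK -natrX.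
  by rewrite -[1]/(1%:R) -natrD pnatr_eq0 addn_eq0.
have u1 k : `|u k| = 1.
  by rewrite /u normf_div -(conju k) norm_conjC mulfV // normr_eq0 -conjC_eq0 conju.
have uI : injective u.
  move=> k l /eqP; rewrite /u eqr_div ?dn0 // => /eqP e.
  apply/eqP; rewrite -(eqr_nat C); apply/eqP.
  have : 2%:R * 'i * (k%:R - l%:R) = 0 :> C.
    by move/eqP: e; rewrite -subr_eq0 => /eqP <-; ring.
  move/eqP; rewrite !mulf_eq0 pnatr_eq0 (negPf (neq0Ci C)) /= subr_eq0.
  by move/eqP.
have := @uniq_leq_size _ [seq u k | k <- iota 0 (size s).+1] s.
rewrite map_inj_uniq // iota_uniq size_map size_iota ltnn => /(_ isT) h.
have : ~~ all [in s] [seq u k | k <- iota 0 (size s).+1].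
  by apply/negP => /allP /h.
by case/allPn => z /mapP [k _ ->] ks; exists (u k).
Qed.

Lemma circle_poly_eq0 p : (forall z, `|z| = 1 -> p.[z] = 0) -> p = 0.
Proof.
move=> p0; apply/eqP; apply/negPn/negP => pn0.
have [rs prs] := closed_field_poly_normal p.
have [z z1 zrs] := circle_infinite rs.
have /eqP := p0 z z1; rewrite -/(root p z) prs rootZ ?lead_coef_eq0 //.
by rewrite root_prod_XsubC (negPf zrs).
Qed.

(** Identities between reversals are proved on the circle, where the conjugate
    of [z] is its inverse. *)
Lemma circle_polyP p q : (forall z, `|z| = 1 -> p.[z] = q.[z]) -> p = q.
Proof.
move=> pq; apply/eqP; rewrite -subr_eq0; apply/eqP; apply: circle_poly_eq0.
by move=> z z1; rewrite hornerD hornerN pq // subrr.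
Qed.

Lemma size_polyM_le m n p q : (size p <= m.+1)%N -> (size q <= n.+1)%N ->
  (size (p * q)%R <= (m + n).+1)%N.
Proof.
move=> sp sq; apply: leq_trans (size_polyMleq p q) _.
by have := leq_add sp sq; rewrite addSn addnS; case: (_ + _)%N => [|k]; rewrite ?ltnS.
Qed.

Lemma crevM m n p q : (size p <= m.+1)%N -> (size q <= n.+1)%N ->
  crev (m + n) (p * q) = crev m p * crev n q.
Proof.
move=> sp sq; apply: circle_polyP => z z1.
have spq : (size (p * q)%R <= (m + n).+1)%N.
  exact: size_polyM_le.
by rewrite hornerM !crev_circle // hornerM rmorphM exprD /=; ring.
Qed.

Lemma crevZ N c q : crev N (c *: q) = c^* *: crev N q.
Proof.
apply/polyP => i; rewrite coefZ !coef_poly; case: ifP; rewrite ?mulr0 //.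
by rewrite coefZ rmorphM.
Qed.

Lemma crevD N p q : crev N (p + q) = crev N p + crev N q.
Proof.
apply/polyP => i; rewrite coefD !coef_poly; case: ifP; rewrite ?addr0 //.
by rewrite coefD rmorphD.
Qed.

Lemma crevN N p : crev N (- p) = - crev N p.
Proof. by rewrite -scaleN1r crevZ rmorphN1 scaleN1r. Qed.

Lemma crev_norm N q z : (size q <= N.+1)%N -> `|z| = 1 ->
  `|(crev N q).[z]| = `|q.[z]|.
Proof.
move=> sq z1.
by rewrite crev_circle // normrM normrX z1 expr1n mul1r norm_conjC.
Qed.

(** The denominators of Blaschke products. *)
Definition zero_free q := forall z, `|z| <= 1 -> q.[z] != 0.

Lemma zero_free_neq0 q : zero_free q -> q != 0.
Proof.
move=> qz; have := qz 0; rewrite normr0 ler01 => /(_ isT).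
by apply: contraNneq => ->; rewrite horner0.
Qed.

(** The zeros of the reversal are the reflections of those of [q], which lie
    outside the closed disc. *)
Lemma crev_root_lt1 N q z : (size q <= N.+1)%N -> zero_free q ->
  root (crev N q) z -> `|z| < 1.
Proof.
move=> sq qz; rewrite /root; case: real_ltP => // z1.
have z0 : z != 0 by rewrite -normr_gt0 (lt_le_trans ltr01).
rewrite horner_crev // mulf_eq0 expf_eq0 (negPf z0) andbF /= conjC_eq0.
apply: contraLR => _; apply: qz; rewrite normfV norm_conjC.
by rewrite invf_le1 // normr_gt0.
Qed.

Lemma coprimep_crev N q : (size q <= N.+1)%N -> zero_free q ->
  coprimep (crev N q) q.
Proof.
move=> sq qz; apply/Pdiv.ClosedField.coprimepP => z /(crev_root_lt1 sq qz).
by move/ltW; apply: qz.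
Qed.

(** The leading coefficient of the reversal is [conj q.[0]]. *)
Lemma size_crev_zero_free N q : zero_free q -> size (crev N q) = N.+1.
Proof.
move=> qz; apply/eqP; rewrite eqn_leq size_crev /= ltnNge.
apply/negP => h; have := nth_default 0 h; rewrite coef_poly ltnSn subnn.
move/eqP; rewrite conjC_eq0 -horner_coef0; apply/negP/qz.
by rewrite normr0 ler01.
Qed.

(** On the circle equal moduli mean [A * crev A = B * crev B]; coprimality lets
    one read off that [A] is [crev B] up to a unimodular constant, and a square
    root of that constant is absorbed into the denominator. *)
Lemma inner_fraction (A B : {poly C}) (N := (maxn (size A) (size B)).-1) :
    coprimep A B -> zero_free B ->
    (forall z, `|z| = 1 -> `|A.[z]| = `|B.[z]|) ->
  exists m : C, m != 0 /\ crev N (m *: B) = m *: A.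
Proof.
move=> cAB Bz AB.
have B0 := zero_free_neq0 Bz.
have mx : (0 < maxn (size A) (size B))%N by rewrite leq_max !size_poly_gt0 B0 orbT.
have sA : (size A <= N.+1)%N by rewrite prednK // leq_maxl.
have sB : (size B <= N.+1)%N by rewrite prednK // leq_maxr.
have e : A * crev N A = B * crev N B.
  apply: circle_polyP => z z1; rewrite !hornerM !crev_circle //.
  by rewrite mulrCA -normCK AB // normCK; ring.
have : A %| crev N B.
  by rewrite -(Gauss_dvdpr _ cAB) -e dvdp_mulr.
case/dvdpP => u uB.
have A0 : A != 0.
  apply/negP => /eqP A0; move: uB; rewrite A0 mulr0.
  by move/eqP; rewrite -size_poly_eq0 size_crev_zero_free.
have uA : crev N A = u * B.
  by apply: (mulfI A0); rewrite e uB; ring.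
have u0 : u != 0.
  apply/negP => /eqP u0; move: uB; rewrite u0 mul0r.
  by move/eqP; rewrite -size_poly_eq0 size_crev_zero_free.
have su : size u = 1%N.
  apply/eqP; rewrite eqn_leq size_poly_gt0 u0 andbT.
  have := size_crev N A; rewrite uA size_mul //.
  have : size (u * A) = N.+1 by rewrite -uB size_crev_zero_free.
  rewrite size_mul //.
  have : (size A == N.+1) || (size B == N.+1).
    by rewrite /N prednK // /maxn; case: ifP; rewrite eqxx ?orbT.
  by case: (size u) => [|[|v]] // /orP [] /eqP ->; lia.
have [c uc] : exists c, u = c%:P.
  by exists u`_0; apply: size1_polyC; rewrite su.
have c0 : c != 0 by move: u0; rewrite uc polyC_eq0.
have nc : `|c| = 1.
  have [z z1 _] := circle_infinite [::].
  have := crev_norm sB z1; rewrite uB uc hornerM hornerC normrM AB //.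
  move=> /(canRL (mulfK _)) ->; rewrite ?divff ?normr_eq0 //;
   by apply: Bz; rewrite z1.
have m0 : sqrtC c != 0 by rewrite sqrtC_eq0.
have m1 : `|sqrtC c| = 1.
  apply/eqP; rewrite -(eqrXn2 (n := 2)) ?normr_ge0 ?ler01 //.
  by rewrite -normrX sqrtCK nc expr1n.
(* With [crev B = c A] and [m] unimodular, [crev (m B) = m^-1 c A]. *)
exists (sqrtC c); split => //.
rewrite crevZ uB uc mul_polyC scalerA (circle_conj m1).
by rewrite -{2}(sqrtCK c) expr2 mulKf.
Qed.

(** For [s = S/T] with [s = conj s * p] on the circle, the zeros of the
    reversal of [T] lie inside the disc, so [T] has to divide the denominator
    [D] of [p]. *)
Lemma common_denominator (S T D : {poly C}) N :
    coprimep S T -> zero_free T -> zero_free D -> (size D <= N.+1)%N ->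
    (forall z, `|z| = 1 ->
      S.[z] / T.[z] = (S.[z] / T.[z])^* * ((crev N D).[z] / D.[z])) ->
  exists E, [/\ E * T = S * D, (size E <= N.+1)%N & crev N E = E].
Proof.
move=> cST Tz Dz sD sp.
pose m := (maxn (size S) (size T)).-1.
have T0 := zero_free_neq0 Tz.
have mx : (0 < maxn (size S) (size T))%N by rewrite leq_max !size_poly_gt0 T0 orbT.
have sS : (size S <= m.+1)%N by rewrite prednK // leq_maxl.
have sT : (size T <= m.+1)%N by rewrite prednK // leq_maxr.
have z1n (z : C) : `|z| = 1 -> T.[z] != 0 /\ D.[z] != 0.
  by move=> z1; split; [apply: Tz|apply: Dz]; rewrite z1.
have e : S * D * crev m T = crev m S * crev N D * T.
  apply: circle_polyP => z z1; have [Tn Dn] := z1n z z1.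
  have Tn' : (T.[z])^* != 0 by rewrite conjC_eq0.
  rewrite !hornerM [(crev m T).[z]]crev_circle // [(crev m S).[z]]crev_circle //.
  have -> : S.[z] = S.[z] / T.[z] * T.[z] by rewrite mulfVK.
  rewrite [X in X * T.[z] * D.[z]]sp // rmorphM fmorphV /= mulfVK //.
  by field; rewrite Tn' Dn.
have [E SD] : exists E : {poly C}, S * D = E * T.
  apply/dvdpP.
  have cTT : coprimep T (crev m T) by rewrite coprimep_sym coprimep_crev.
  by rewrite -(Gauss_dvdpl _ cTT) e dvdp_mull.
exists E.
have ET : E * crev m T = crev m S * crev N D.
  by apply: (mulIf T0); rewrite -e SD; ring.
have sE : (size E <= N.+1)%N.
  have [->|E0] := eqVneq E 0; first by rewrite size_poly0.
  have cT : size (crev m T) = m.+1 by rewrite size_crev_zero_free.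
  have := size_polyMleq (crev m S) (crev N D).
  rewrite -ET size_mul ?cT //; last by rewrite -size_poly_eq0 cT.
  have ar (a b c l : nat) : (a <= N.+1)%N -> (b <= l.+1)%N ->
    ((c + l.+1).-1 <= (b + a).-1)%N -> (c <= N.+1)%N by lia.
  exact: ar (size_crev N D) (size_crev m S).
split => //.
apply: circle_polyP => z z1; have [Tn Dn] := z1n z z1.
rewrite crev_circle //.
have -> : E.[z] = S.[z] * D.[z] / T.[z].
  by rewrite -hornerM SD hornerM mulfK.
have Tn' : (T.[z])^* != 0 by rewrite conjC_eq0.
rewrite mulrAC [in RHS]sp // !(rmorphM, fmorphV) /= crev_circle //.
by field; rewrite Tn' Dn.
Qed.

End Reversal.

(** * Boundary estimates for polynomials *)

Section Estimates.
Variable C : numClosedFieldType.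
Implicit Types (p q : {poly C}) (z : C) (N : nat).

(** Limits [t -> 0] are taken in this form, which makes sense over any
    algebraically closed field with a norm. *)
Lemma le_small0 (x K : C) : 0 <= x -> 0 <= K ->
  (forall t, 0 < t -> t <= 1 -> x <= K * t) -> x = 0.
Proof.
move=> x0 K0 h; apply/eqP/negPn/negP => xn.
have xp : 0 < x by rewrite lt_def xn.
have yp : 0 < x + K + 1 by rewrite ltr_wpDl ?addr_ge0.
have t1 : x / (x + K + 1) <= 1.
  by rewrite ler_pdivrMr // mul1r -addrA lerDl addr_ge0.
have := h (x / (x + K + 1)) (divr_gt0 xp yp) t1.
rewrite mulrCA -[X in X <= _]mulr1 ler_pM2l // ler_pdivlMr // mul1r -subr_ge0.
have -> : K - (x + K + 1) = - (x + 1) by ring.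
by rewrite oppr_ge0 lt_geF // addr_gt0.
Qed.

Lemma poly_bound q : exists2 K : C, 0 <= K & forall z, `|z| <= 1 -> `|q.[z]| <= K.
Proof.
exists (\sum_(i < size q) `|q`_i|); first by apply: sumr_ge0 => i _.
move=> z z1; rewrite horner_coef; apply: le_trans (ler_norm_sum _ _ _) _.
apply: ler_sum => i _; rewrite normrM normrX ler_piMr //.
exact: exprn_ile1.
Qed.

Lemma root_factor q z : exists q1, q = q.[z]%:P + ('X - z%:P) * q1.
Proof.
have : root (q - q.[z]%:P) z by rewrite /root !hornerE subrr.
case/factor_theorem => q1 e; exists q1; rewrite [_ * q1]mulrC -e; ring.
Qed.

Lemma disc_approach z0 (t : C) : `|z0| <= 1 -> 0 < t -> t <= 1 ->
  exists z, [/\ `|z| < 1, z != z0 & `|z - z0| <= 2 * t].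
Proof.
move=> z01 t0 t1.
(* Move towards a point [w] of the open disc other than [z0]. *)
pose w : C := if z0 == 0 then 2^-1 else 0.
have w1 : `|w| < 1.
  rewrite /w; case: ifP; rewrite ?normr0 ?ltr01 //.
  by rewrite ger0_norm ?invr_ge0 ?ler0n // invf_lt1 ?ltr1n ?ltr0n.
have wz : w - z0 != 0.
  rewrite /w subr_eq0; case: (eqVneq z0 0) => [->|]; last by rewrite eq_sym.
  by rewrite invr_eq0 pnatr_eq0.
pose z := z0 + t * (w - z0).
have zz : z - z0 = t * (w - z0) by rewrite /z; ring.
exists z; split.
- have -> : z = (1 - t) * z0 + t * w by rewrite /z; ring.
  apply: le_lt_trans (ler_normD _ _) _; rewrite !normrM.
  rewrite [`|t|]ger0_norm ?(ltW t0) // ger0_norm ?subr_ge0 //.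
  apply: (@le_lt_trans _ _ ((1 - t) + t * `|w|)).
    by rewrite lerD2r ler_piMr // subr_ge0.
  by rewrite -addrA gtrDl addrC subr_lt0 gtr_pMr.
- by rewrite -subr_eq0 zz mulf_neq0 // gt_eqF.
- rewrite zz normrM ger0_norm ?(ltW t0) // mulrC ler_pM2r //.
  by apply: le_trans (ler_normB _ _) _; rewrite -[2]/(1 + 1) lerD // ltW.
Qed.

Lemma poly_lipschitz q z0 : exists2 K : C, 0 <= K &
  forall z, `|z| <= 1 -> `|q.[z] - q.[z0]| <= K * `|z - z0|.
Proof.
have [q1 e] := root_factor q z0; have [K K0 q1K] := poly_bound q1.
exists K => // z z1; rewrite e !hornerE subrr mul0r addr0 addrAC subrr add0r.
by rewrite normrM mulrC ler_wpM2r // q1K.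
Qed.

Lemma horner_eq0_of_bound q z0 (K : C) : `|z0| <= 1 -> 0 <= K ->
  (forall z, `|z| < 1 -> z != z0 -> `|q.[z]| <= K * `|z - z0|) -> q.[z0] = 0.
Proof.
move=> z01 K0 h; have [K1 K10 qK] := poly_lipschitz q z0.
apply/eqP; rewrite -normr_eq0; apply/eqP.
apply: (@le_small0 _ ((K + K1) * 2)) => //.
  by rewrite mulr_ge0 ?ler0n // addr_ge0.
move=> t t0 t1; have [z [zlt zn d2]] := disc_approach z01 t0 t1.
have -> : q.[z0] = q.[z] - (q.[z] - q.[z0]) by ring.
apply: le_trans (ler_normB _ _) _.
apply: (@le_trans _ _ (K * `|z - z0| + K1 * `|z - z0|)).
  by rewrite lerD // ?h // qK // ltW.
by rewrite -mulrDl -mulrA ler_wpM2l // addr_ge0.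
Qed.

Lemma closed_disc_le p q (c : C) : 0 <= c ->
    (forall z, `|z| < 1 -> `|p.[z]| <= c * `|q.[z]|) ->
  forall z, `|z| <= 1 -> `|p.[z]| <= c * `|q.[z]|.
Proof.
move=> c0 h z0 z01; rewrite real_leNgt ?rpredM ?ger0_real //; apply/negP => lt0.
have [K1 K10 pK] := poly_lipschitz p z0; have [K2 K20 qK] := poly_lipschitz q z0.
suff : `|p.[z0]| - c * `|q.[z0]| = 0.
  by apply/eqP; rewrite gt_eqF // subr_gt0.
apply: (@le_small0 _ ((K1 + c * K2) * 2)).
- by rewrite subr_ge0 ltW.
- by rewrite mulr_ge0 ?ler0n // addr_ge0 // mulr_ge0.
move=> t t0 t1; have [z [zlt zn d2]] := disc_approach z01 t0 t1.
have z1 := ltW zlt.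
apply: (@le_trans _ _ ((K1 + c * K2) * `|z - z0|)); last first.
  by rewrite -mulrA ler_wpM2l // addr_ge0 // mulr_ge0.
have pz : `|p.[z0]| <= `|p.[z]| + K1 * `|z - z0|.
  have -> : p.[z0] = p.[z] - (p.[z] - p.[z0]) by ring.
  by apply: le_trans (ler_normB _ _) _; rewrite lerD2l pK.
have qz : `|q.[z]| <= `|q.[z0]| + K2 * `|z - z0|.
  have -> : q.[z] = q.[z0] + (q.[z] - q.[z0]) by ring.
  by apply: le_trans (ler_normD _ _) _; rewrite lerD2l qK.
rewrite lerBlDr; apply: le_trans pz _.
apply: le_trans (lerD (h z zlt) (lexx _)) _.
apply: le_trans (lerD (ler_wpM2l c0 qz) (lexx _)) _.
by rewrite le_eqVlt; apply/orP; left; apply/eqP; ring.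
Qed.

(** If [B] had a zero [z0] of order [m > 0] in the closed disc, then [A] would be
    [O(|z - z0|^m)] within the disc, and so vanish at [z0] like [B]. *)
Lemma bounded_fraction_zero_free (A B : {poly C}) (K : C) :
    coprimep A B -> B != 0 -> 0 <= K ->
    (forall z, `|z| < 1 -> `|A.[z] / B.[z]| <= K) -> zero_free B.
Proof.
move=> cAB B0 K0 h z0 z01; apply/negP => Bz.
have [[|m] [B1 B1z e]] := multiplicity_XsubC B z0.
  by move: B1z Bz; rewrite B0 e expr0 mulr1 /root => /= /negPf ->.
have {}B1z : B1.[z0] != 0 by move: B1z; rewrite B0.
have Az : A.[z0] != 0.
  by move: cAB; rewrite coprimep_sym => /coprimep_root; apply.
(* Multiplying by [B1] gives a bound that also holds at the other zeros of [B]. *)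
have := mulf_neq0 Az B1z; rewrite -hornerM => /negP; apply; apply/eqP.
have [K1 K10 B1K] := poly_bound B1.
have [K2 K20 XK] := poly_bound (('X - z0%:P) ^+ m).
apply: (@horner_eq0_of_bound _ _ (K * K2 * K1 * K1)) => //.
  by rewrite !mulr_ge0.
move=> z zlt zn; have z1 := ltW zlt.
have [B1z0|B1n] := eqVneq B1.[z] 0.
  by rewrite hornerM B1z0 mulr0 normr0 !mulr_ge0.
have Bn : B.[z] != 0.
  by rewrite e hornerM mulf_neq0 // horner_exp expf_neq0 // !hornerE subr_eq0.
have Ble : `|B.[z]| <= K2 * K1 * `|z - z0|.
  have -> : B.[z] = (('X - z0%:P) ^+ m).[z] * B1.[z] * (z - z0).
    by rewrite e exprS !hornerM hornerXsubC; ring.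
  by rewrite !normrM ler_wpM2r // ler_pM // ?XK ?B1K.
rewrite hornerM normrM -(mulfVK Bn A.[z]) normrM.
apply: (@le_trans _ _ (K * (K2 * K1 * `|z - z0|) * K1)).
  by rewrite !ler_pM ?mulr_ge0 // ?h ?B1K.
by rewrite le_eqVlt; apply/orP; left; apply/eqP; ring.
Qed.

(** For small [t > 0] the values at [t] and [- t] have opposite signs, so that
    [|r.[t]| + |r.[- t]|] is the modulus of [r.[- t] - r.[t]], which tends
    to 0. *)
Lemma odd_sign_vanish (r : {poly C}) :
  (forall t, t \is Num.real -> t * r.[t] <= 0) -> r.[0] = 0.
Proof.
move=> h; have [r1 e] := root_factor r 0.
have [K K0 rK] := poly_bound r1.
apply/eqP; rewrite -normr_eq0; apply/eqP.
apply: (@le_small0 _ (2 * K)) => //; first by rewrite mulr_ge0 ?ler0n.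
move=> t t0 t1; have tr : t \is Num.real by rewrite gtr0_real.
have rp : r.[t] <= 0 by have := h t tr; rewrite pmulr_rle0.
have rn : 0 <= r.[- t].
  by have := h (- t); rewrite rpredN tr mulNr oppr_le0 pmulr_rge0 // => /(_ isT).
have d : `|r.[- t] - r.[t]| = `|r.[- t]| + `|r.[t]|.
  by rewrite ger0_norm ?subr_ge0 ?(le_trans rp) // (ger0_norm rn) (ler0_norm rp).
have nt : `|t| = t by rewrite gtr0_norm.
have r1b (x : C) : `|x| = t -> `|x * r1.[x]| <= K * t.
  by move=> xt; rewrite normrM xt mulrC ler_wpM2r ?(ltW t0) // rK // xt.
have ev x : r.[x] = r.[0] + x * r1.[x] by rewrite {1}e !hornerE subr0.
have le1 : `|r.[- t] - r.[t]| <= 2 * (K * t).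
  have -> : r.[- t] - r.[t] = (- t) * r1.[- t] - t * r1.[t].
    by rewrite (ev t) (ev (- t)); ring.
  by apply: le_trans (ler_normB _ _) _; rewrite mulr_natl mulr2n lerD ?r1b ?normrN.
have le2 : 2 * `|r.[0]| - 2 * (K * t) <= `|r.[- t]| + `|r.[t]|.
  apply: le_trans (ler_normD _ _).
  have -> : r.[- t] + r.[t] = 2 * r.[0] + ((- t) * r1.[- t] + t * r1.[t]).
    by rewrite (ev t) (ev (- t)); ring.
  have : `|2 * r.[0]| = 2 * `|r.[0]| by rewrite normrM normr_nat.
  move=> <-; apply: le_trans (lerB_normD _ _); rewrite lerD2l lerN2.
  by apply: le_trans (ler_normD _ _) _; rewrite mulr_natl mulr2n lerD ?r1b ?normrN.
have : 2 * `|r.[0]| <= 4 * (K * t).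
  have -> : 4 * (K * t) = 2 * (K * t) + 2 * (K * t) by ring.
  by rewrite -lerBlDr (le_trans le2) // -d.
have -> : 4 * (K * t) = 2 * (2 * K * t) by ring.
by rewrite ler_pM2l ?ltr0n.
Qed.

(** The Cayley map [t |-> (1 + i t)/(1 - i t)] turns [z ^- N * G.[z]] into a
    polynomial in a real variable, up to the positive factor [(1 + t^2)^N];
    a real function of constant sign has no simple zero. *)
Lemma boundary_zero_double (G : {poly C}) N (x : C) :
    (size G <= N.*2.+1)%N -> `|x| = 1 ->
    (forall z, `|z| = 1 -> z ^- N * G.[z] <= 0) ->
  root G x -> ('X - x%:P) ^+ 2 %| G.
Proof.
move=> sG x1 Gle /factor_theorem [H GH].
suff : root H x.
  by case/factor_theorem => H1 e; rewrite GH e -mulrA dvdp_mulIr.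
have x0 := circle_neq0 x1.
have [G0|Gn] := eqVneq G 0.
  move: GH; rewrite G0 => /esym /eqP; rewrite mulf_eq0 polyXsubC_eq0 orbF.
  by move=> /eqP ->; rewrite root0.
have sH : (size H <= N.*2)%N.
  have Hn : H != 0 by apply: contraNneq Gn => H0; rewrite GH H0 mul0r.
  by move: sG; rewrite GH size_Mmonic ?monicXsubC // size_XsubC addnC.
have Hn : H != 0 by apply: contraNneq Gn => H0; rewrite GH H0 mul0r.
case: N sG Gle sH => [|N] sG Gle sH.
  by move: Hn; rewrite -size_poly_eq0 -leqn0 sH.
(* Up to a constant, [r.[t]] is [(1 - i t)^(2 N + 1)] times [H] at the point
   [x (1 + i t) / (1 - i t)], and [(1 + i t) / (1 - i t) - 1 = 2 i t / (1 - i t)]. *)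
pose a : {poly C} := 1 + 'i *: 'X.
pose b : {poly C} := 1 - 'i *: 'X.
pose r := (2 * 'i * x * x ^- N.+1) *:
  \sum_(k < N.+1.*2) (H`_k * x ^+ k) *: (a ^+ k * b ^+ (N.*2.+1 - k)).
have : r.[0] = 0.
  apply: odd_sign_vanish => t tr.
  pose u := 1 + 'i * t; pose v := 1 - 'i * t.
  have uv : u * v = 1 + t ^+ 2.
    have -> : u * v = 1 - 'i ^+ 2 * t ^+ 2 by rewrite /u /v; ring.
    by rewrite sqrCi; ring.
  have cu : u^* = v.
    by rewrite /u rmorphD rmorph1 rmorphM /= conjCi (CrealP tr) mulNr.
  have uvp : 0 < u * v by rewrite uv ltr_pwDl // -realEsqr.
  have un : u != 0 by apply/eqP => u0; move: uvp; rewrite u0 mul0r ltxx.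
  have vn : v != 0 by apply/eqP => v0; move: uvp; rewrite v0 mulr0 ltxx.
  have zc : `|x * (u / v)| = 1.
    by rewrite normrM x1 mul1r normf_div -cu norm_conjC divff // normr_eq0.
  have rE : t * r.[t] = ((x * (u / v)) ^- N.+1 * G.[x * (u / v)]) * (u * v) ^+ N.+1.
    have av : a.[t] = u by rewrite /a !hornerE.
    have bv : b.[t] = v by rewrite /b !hornerE.
    have -> : r.[t] = 2 * 'i * x * x ^- N.+1 * (H.[x * (u / v)] * v ^+ N.*2.+1).
      rewrite /r hornerZ horner_sum (horner_coef_wide _ sH) mulr_suml.
      congr (_ * _); apply: eq_bigr => k _.
      rewrite hornerZ hornerM !horner_exp av bv.
      have kN : (k <= N.*2.+1)%N by rewrite -ltnS -doubleS.
      rewrite -[in RHS](subnK kN) exprD !exprMn exprVn.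
      by field; rewrite expf_neq0.
    rewrite GH hornerM hornerXsubC.
    have -> : x * (u / v) - x = x * (2 * 'i * t / v).
      by rewrite /u /v; field.
    have -> : v ^+ N.*2.+1 = v * v ^+ N * v ^+ N.
      by rewrite exprS -addnn exprD mulrA.
    rewrite !exprMn exprVn ![_ ^+ N.+1]exprS.
    by field; rewrite x0 un vn !expf_neq0.
  by rewrite rE pmulr_lle0 ?exprn_gt0 // Gle.
rewrite /r hornerZ horner_sum => /eqP; rewrite mulf_eq0 => /orP [].
  rewrite !mulf_eq0 pnatr_eq0 (negPf (neq0Ci C)) (negPf x0) invr_eq0 expf_eq0.
  by rewrite (negPf x0) andbF.
rewrite /root (horner_coef_wide _ sH) => /eqP s0; apply/eqP.
rewrite -[RHS]s0; apply: eq_bigr => k _.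
have a0 : a.[0] = 1 by rewrite !hornerE ?mulr0 ?addr0.
have b0 : b.[0] = 1 by rewrite !hornerE ?mulr0 ?subr0 ?addr0 ?oppr0.
by rewrite hornerZ hornerM !horner_exp a0 b0 !expr1n !mulr1.
Qed.
End Estimates.

(** * Blaschke products *)

Section BlaschkeProducts.
Variable C : numClosedFieldType.
Implicit Types (p q P Q : {poly C}) (z r : C) (N : nat).

(** The phasar derivative of [P / Q], as a difference of logarithmic
    derivatives. *)
Definition log_phasar P Q z := z * (P^`().[z] / P.[z] - Q^`().[z] / Q.[z]).

Lemma log_phasarM P1 Q1 P2 Q2 z :
    P1.[z] != 0 -> Q1.[z] != 0 -> P2.[z] != 0 -> Q2.[z] != 0 ->
  log_phasar (P1 * P2) (Q1 * Q2) z = log_phasar P1 Q1 z + log_phasar P2 Q2 z.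
Proof.
move=> p1 q1 p2 q2; rewrite /log_phasar !derivM !hornerE.
by field; rewrite p1 q1 p2 q2.
Qed.

Lemma crev_XsubC r : crev 1 ('X - r%:P) = 1 - r^* *: 'X.
Proof.
apply: circle_polyP => z z1; rewrite crev_circle ?size_XsubC // expr1 !hornerE.
by rewrite rmorphB /= (circle_conj z1) mulrBr mulfV ?circle_neq0 // mulrC.
Qed.

Lemma blaschke_factor_lt r z : `|z| < 1 -> 1 < `|r| ->
  `|(crev 1 ('X - r%:P)).[z]| < `|('X - r%:P).[z]|.
Proof.
move=> z1 r1; rewrite crev_XsubC !hornerE.
rewrite -(ltr_pXn2r (n := 2)) ?nnegrE // -subr_gt0.
have -> : `|z - r| ^+ 2 - `|1 - r^* * z| ^+ 2
    = (`|r| ^+ 2 - 1) * (1 - `|z| ^+ 2).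
  by rewrite !normCK !rmorphB !rmorphM rmorph1 /= conjCK; ring.
by rewrite mulr_gt0 // subr_gt0 ?exprn_ilt1 ?exprn_egt1.
Qed.

(** The phasar derivative is the Poisson-type kernel
    [(|r|^2 - 1) / |z - r|^2]. *)
Lemma blaschke_factor_phasar r z : `|z| = 1 -> 1 < `|r| ->
  0 < log_phasar (crev 1 ('X - r%:P)) ('X - r%:P) z.
Proof.
move=> z1 r1; have z0 := circle_neq0 z1; have cz := circle_conj z1.
have zr : z - r != 0.
  by rewrite subr_eq0; apply: contraTneq r1 => <-; rewrite z1 ltxx.
have e : 1 - r^* * z = z * (z - r)^*.
  by rewrite rmorphB /= cz mulrBr mulfV //; ring.
rewrite /log_phasar crev_XsubC derivB derivC derivZ derivX derivXsubC !hornerE.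
have zr' : (z - r)^* != 0 by rewrite conjC_eq0.
have -> : z * (- r^* / (1 - r^* * z) - (z - r)^-1)
     = (`|r| ^+ 2 - 1) / `|z - r| ^+ 2.
  have rE : r^* = z^-1 - (z - r)^* by rewrite rmorphB /= cz; ring.
  rewrite e !normCK {}rE; move: (_^*) zr' => w wn.
  by field; rewrite z0 zr wn.
by rewrite divr_gt0 ?exprn_gt0 ?normr_gt0 // subr_gt0 exprn_egt1.
Qed.

(** Peeling off one Blaschke factor, or one factor [z] when the denominator is
    constant; each factor contributes strictly. *)
Lemma blaschke_bounds N Q : (size Q <= N.+1)%N -> zero_free Q ->
  (forall z, `|z| < 1 -> `|(crev N Q).[z]| < `|Q.[z]| ?<= if (N == 0%N)) /\
  (forall z, `|z| = 1 -> 0 < log_phasar (crev N Q) Q z ?<= if (N == 0%N)).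
Proof.
elim: N Q => [|N IH] Q sQ Qz.
  have [c ->] : exists c, Q = c%:P by exists Q`_0; apply: size1_polyC.
  have -> : crev 0 c%:P = (c^*)%:P.
    by apply/polyP => i; rewrite coef_poly !coefC; case: i.
  split=> z _ /=; first by rewrite !hornerC norm_conjC.
  by rewrite /log_phasar !derivC !horner0 !mul0r subrr mulr0.
have [L [Q1 [QE cQE sQ1 Ll Lp]]] : exists L Q1 : {poly C},
    [/\ Q = L * Q1, crev N.+1 Q = crev 1 L * crev N Q1, (size Q1 <= N.+1)%N,
      forall z, `|z| < 1 -> `|(crev 1 L).[z]| < `|L.[z]| &
      forall z, `|z| = 1 -> 0 < log_phasar (crev 1 L) L z].
  have [/closed_rootP [r Qr]|/negPn/eqP sQ0] := boolP (size Q != 1%N).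
    have r1 : 1 < `|r|.
      rewrite real_ltNge ?rpred1 ?normr_real //; apply/negP => /Qz.
      by rewrite -/(root Q r) Qr.
    have /factor_theorem [Q1 e] := Qr.
    have Q10 : Q1 != 0.
      by apply: contraNneq (zero_free_neq0 Qz) => e1; rewrite e e1 mul0r.
    have sQ1 : (size Q1 <= N.+1)%N.
      by move: sQ; rewrite e size_Mmonic ?monicXsubC // size_XsubC addnC.
    exists ('X - r%:P), Q1; split => //.
    - by rewrite e mulrC.
    - by rewrite e mulrC -(crevM (m := 1)) ?size_XsubC.
    - by move=> z z1; apply: blaschke_factor_lt.
    - by move=> z z1; apply: blaschke_factor_phasar.
  have c1 : crev 1 (1 : {poly C}) = 'X.
    apply: circle_polyP => z z1.
    by rewrite crev_circle ?size_poly1 // !hornerE rmorph1 mulr1.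
  exists 1, Q; split.
  - by rewrite mul1r.
  - by rewrite -(crevM (m := 1)) ?size_poly1 ?mul1r ?sQ0.
  - by rewrite sQ0.
  - by move=> z z1; rewrite c1 !hornerE normr1.
  - move=> z z1; rewrite c1 /log_phasar derivX derivC !hornerE.
    by rewrite subr0 mulfV ?circle_neq0.
have Q1z : zero_free Q1.
  by move=> z /Qz; rewrite QE hornerM; apply: contraNneq => ->; rewrite mulr0.
have [IH1 IH2] := IH Q1 sQ1 Q1z.
split=> z z1 /=.
  rewrite cQE QE !hornerM !normrM.
  apply: (@le_lt_trans _ _ (`|(crev 1 L).[z]| * `|Q1.[z]|)).
    by rewrite ler_wpM2l // (lteifW (IH1 z z1)).
  by rewrite ltr_pM2r ?normr_gt0 ?Ll // Q1z // ltW.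
have zn : Q.[z] != 0 by rewrite Qz ?z1.
have zcn : (crev N.+1 Q).[z] != 0.
  by rewrite -normr_eq0 crev_norm // normr_eq0.
move: zn zcn; rewrite cQE {1}QE !hornerM !mulf_eq0 !negb_or.
case/andP => Ln Q1n /andP [cLn cQ1n].
by rewrite QE log_phasarM // ltr_pwDl ?Lp // (lteifW (IH2 z z1)).
Qed.

Lemma blaschke_lt N Q z : (0 < N)%N -> (size Q <= N.+1)%N -> zero_free Q ->
  `|z| < 1 -> `|(crev N Q).[z]| < `|Q.[z]|.
Proof. by case: N => // N _ sQ Qz z1; apply: (blaschke_bounds sQ Qz).1. Qed.

Lemma blaschke_phasar_gt0 N Q z :
  (0 < N)%N -> (size Q <= N.+1)%N -> zero_free Q ->
  `|z| = 1 -> 0 < log_phasar (crev N Q) Q z.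
Proof. by case: N => // N _ sQ Qz z1; apply: (blaschke_bounds sQ Qz).2. Qed.

End BlaschkeProducts.

(** * Lowest terms of rational functions *)

Section LowestTerms.
Variable F : fieldType.
Implicit Types (A B g : {poly F}) (f : {fraction {poly F}}) (z : F).

Lemma lowest_terms f A B : B != 0 -> f = A%:F / B%:F ->
  exists2 g, g != 0 & A = rnum f * g /\ B = rden f * g.
Proof.
move=> B0 fE; have d0 := rden_neq0 f.
have e : rnum f * B = A * rden f.
  apply/eqP; rewrite -tofrac_eq !tofracM; apply/eqP.
  have := rnum_rdenE f; rewrite {1}fE => /eqP.
  by rewrite eqr_div ?tofrac_eq0 // => /eqP ->.
have : rden f %| B.
  have := coprimep_rnum_rden f; rewrite coprimep_sym => c.
  by rewrite -(Gauss_dvdpr _ c) e dvdp_mull.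
move=> /dvdpP [g Bg]; exists g.
  by apply: contraNneq B0; rewrite Bg => ->; rewrite mul0r.
split; last by rewrite Bg mulrC.
by apply: (mulIf d0); rewrite -e Bg; ring.
Qed.

Lemma reval_frac f A B z : B.[z] != 0 -> f = A%:F / B%:F ->
  reval f z = A.[z] / B.[z].
Proof.
move=> Bz fE; have B0 : B != 0 by apply: contraNneq Bz => ->; rewrite horner0.
have [g _ [AE BE]] := lowest_terms B0 fE.
move: Bz; rewrite AE BE !hornerM mulf_eq0 negb_or => /andP [d g0].
by rewrite -mulf_div divff // mulr1.
Qed.

Lemma rden_nonzero f A B z : B.[z] != 0 -> f = A%:F / B%:F -> (rden f).[z] != 0.
Proof.
move=> Bz fE; have B0 : B != 0 by apply: contraNneq Bz => ->; rewrite horner0.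
have [g _ [AE BE]] := lowest_terms B0 fE.
by move: Bz; rewrite BE hornerM mulf_eq0 negb_or => /andP [].
Qed.

Lemma rdegree_frac f A B : B != 0 -> coprimep A B -> f = A%:F / B%:F ->
  rdegree f = (maxn (size A) (size B)).-1.
Proof.
move=> B0 cAB fE; have [g g0 [AE BE]] := lowest_terms B0 fE.
have sg : size g = 1%N.
  apply/eqP; rewrite -dvdp1; have /coprimepP := cAB; move/(_ g).
  rewrite AE BE !dvdp_mulIr => /(_ isT isT) /eqp_dvdl ->; exact: dvdpp.
have [c gc] : exists c, g = c%:P by exists g`_0; apply: size1_polyC; rewrite sg.
have c0 : c != 0 by move: g0; rewrite gc polyC_eq0.
by rewrite /rdegree AE BE gc ![_ * c%:P]mulrC !mul_polyC !size_scale.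
Qed.

Lemma zero_order_frac f A B z : A != 0 -> B.[z] != 0 -> f = A%:F / B%:F ->
  zero_order f z = mup z A.
Proof.
move=> A0 Bz fE; have B0 : B != 0 by apply: contraNneq Bz => ->; rewrite horner0.
have [g g0 [AE BE]] := lowest_terms B0 fE.
rewrite /zero_order AE mupMl // /root.
by move: Bz; rewrite BE hornerM mulf_eq0 negb_or => /andP [].
Qed.

(** A quotient written with the degree of the rational function as a bound is in
    lowest terms, so two such expressions differ by a constant. *)
Lemma fraction_proportional f n A B : B != 0 -> f = A%:F / B%:F ->
    (size A <= n.+1)%N -> (size B <= n.+1)%N -> rdegree f = n ->
  exists2 g : F, g != 0 & A = g *: rnum f /\ B = g *: rden f.
Proof.
move=> B0 fE sA sB df; have [g g0 [AE BE]] := lowest_terms B0 fE.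
have d0 := rden_neq0 f.
suff sg : size g = 1%N.
  have [c gc] : exists c, g = c%:P by exists g`_0; apply: size1_polyC; rewrite sg.
  exists c; first by move: g0; rewrite gc polyC_eq0.
  by rewrite -!mul_polyC -gc AE BE ![g * _]mulrC.
have sB' : ((size (rden f) + size g).-1 <= n.+1)%N by rewrite -size_mul // -BE.
have sg0 : (0 < size g)%N by rewrite size_poly_gt0.
have sd0 : (0 < size (rden f))%N by rewrite size_poly_gt0.
have [a0|a0] := eqVneq (rnum f) 0.
  by move: df; rewrite /rdegree a0 size_poly0; move: sB' sg0 sd0; lia.
have sA' : ((size (rnum f) + size g).-1 <= n.+1)%N by rewrite -size_mul // -AE.
by move: df; rewrite /rdegree; move: sA' sB' sg0 sd0; lia.
Qed.

End LowestTerms.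

(** * Derivatives and radial limits *)

Section Calculus.
Variable R : realType.
Local Notation C := R[i].
Implicit Types (P Q : {poly C}) (z : C) (f : {fraction {poly C}}).

Lemma is_derive_horner P z :
  is_derive (z : C^o) (1 : C^o) (horner P : C^o -> C^o) P^`().[z].
Proof.
elim/poly_ind: P => [|P c IH].
  have -> : (horner 0 : C^o -> C^o) = cst 0 by apply/funext => y; rewrite horner0.
  by rewrite deriv0 horner0; exact: is_derive_cst.
have -> : (horner (P * 'X + c%:P) : C^o -> C^o)
   = (horner P : C^o -> C^o) * id + cst (c : C^o).
  by apply/funext => y; rewrite hornerMXaddC.
apply: is_derive_eq.
by rewrite derivD derivM derivC derivX !hornerE /GRing.scale /=; ring.
Qed.

Lemma is_derive_reval f z : (rden f).[z] != 0 ->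
  is_derive (z : C^o) (1 : C^o) (reval f : C^o -> C^o)
    (((rnum f)^`().[z] * (rden f).[z] - (rnum f).[z] * (rden f)^`().[z])
       / (rden f).[z] ^+ 2).
Proof.
move=> d0.
have dn := is_derive_horner (rnum f) z; have dd := is_derive_horner (rden f) z.
have -> : (reval f : C^o -> C^o) = (horner (rnum f) : C^o -> C^o)
    * (fun y : C^o => (horner (rden f) y)^-1 : C^o) by [].
have dv : is_derive (z : C^o) (1 : C^o)
    (fun y : C^o => (horner (rden f) y)^-1 : C^o)
    (- ((rden f).[z]) ^- 2 *: (rden f)^`().[z]).
  apply: DeriveDef; first by apply: derivableV => //; exact: ex_derive.
  by rewrite deriveV // derive_val.
apply: is_derive_eq.
by rewrite /GRing.scale /=; field.
Qed.

Lemma derivable_reval f z : (rden f).[z] != 0 ->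
  derivable (reval f : C^o -> C^o) z 1.
Proof. by move=> /is_derive_reval [+ _]. Qed.

Lemma continuous_reval f z : (rden f).[z] != 0 ->
  {for z, continuous (reval f : C^o -> C^o)}.
Proof.
by move=> /derivable_reval /derivable1_diffP /differentiable_continuous.
Qed.

Lemma derive1_reval_frac f P Q z : Q.[z] != 0 -> f = P%:F / Q%:F ->
  derive1 (reval f : C^o -> C^o) z
    = (P^`().[z] * Q.[z] - P.[z] * Q^`().[z]) / Q.[z] ^+ 2.
Proof.
move=> Qz fE; have dz := rden_nonzero Qz fE.
have Q0 : Q != 0 by apply: contraNneq Qz => ->; rewrite horner0.
have [g g0 [PE QE]] := lowest_terms Q0 fE.
have gz : g.[z] != 0 by move: Qz; rewrite QE hornerM mulf_eq0 negb_or => /andP [].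
have dr := is_derive_reval dz.
rewrite derive1E derive_val [in RHS]PE [in RHS]QE !derivM !(hornerD, hornerM).
by field; rewrite dz gz.
Qed.

Lemma phasar_derivative_frac f P Q z : P.[z] != 0 -> Q.[z] != 0 ->
  f = P%:F / Q%:F -> phasar_derivative f z = log_phasar P Q z.
Proof.
move=> Pz Qz fE; rewrite /phasar_derivative (derive1_reval_frac Qz fE).
by rewrite (reval_frac Qz fE) /log_phasar; field; rewrite Pz Qz.
Qed.

Lemma real_complex_cvg (f : R -> R) (F : set_system R) (l : R) : Filter F ->
  f @ F --> l -> (fun r => (f r)%:C : C^o) @ F --> (l%:C : C^o).
Proof.
move=> FF fl; apply/cvgrPdist_lt => e; rewrite ltcE /= => /andP [/eqP ei er].
move/cvgrPdist_lt: fl => /(_ _ er); apply: filterS => r h.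
have -> : e = (complex.Re e)%:C by apply/eqP; rewrite eq_complex /= ei !eqxx.
by rewrite -rmorphB /= normc_def /= expr0n /= addr0 sqrtr_sqr ltcR.
Qed.

(** A rational function is continuous off its poles. *)
Lemma radial_limit_reval f z : (rden f).[z] != 0 ->
  radial_limit (reval f) z (reval f z).
Proof.
move=> dz; rewrite /radial_limit.
have := continuous_reval dz; apply: cvg_comp.
suff : (fun r : R => r%:C * z : C^o) @ 1^'- --> (1%:C * z : C^o) by rewrite mul1r.
apply: cvgM; last exact: cvg_cst.
apply: (@real_complex_cvg id); apply: cvg_at_left_filter; exact: cvg_id.
Qed.

Lemma radial_limit_unique f z (l : C) : (rden f).[z] != 0 ->
  radial_limit (reval f) z l -> l = reval f z.
Proof.
move=> dz fl; have := radial_limit_reval dz; move: fl.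
exact: norm_cvg_unique.
Qed.

Lemma norm_expi (t : R) : `|expi t| = 1.
Proof. by rewrite /expi normc_def /= cos2Dsin2 sqrtr1. Qed.

Lemma expi_surj z : `|z| = 1 -> exists t, z = expi t.
Proof.
move=> /(congr1 (fun x => x ^+ 2)); rewrite -add_Re2_Im2 expr1n => /complexI.
case: z => x y /= xy1.
have x1 : -1 <= x <= 1 by apply/andP; split; nra.
have sx : sin (acos x) = `|y|.
  by rewrite sin_acos // -xy1 addrC addKr sqrtr_sqr.
have [y0|y0] := leP 0 y.
  by exists (acos x); rewrite /expi acosK ?in_itv //= sx ger0_norm.
by exists (- acos x); rewrite /expi cosN sinN acosK ?in_itv //= sx ltr0_norm // opprK.
Qed.

Lemma continuous_expi : continuous (@expi R : R -> C^o).
Proof.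
move=> t; have -> : (@expi R : R -> C^o)
   = fun t => (cos t)%:C + 'i%C * (sin t)%:C by apply/funext => u; exact: complexE.
apply: cvgD; first by apply: real_complex_cvg; exact: continuous_cos.
by apply: cvgM; [exact: cvg_cst | apply: real_complex_cvg; exact: continuous_sin].
Qed.

Lemma continuous_conj : continuous (Num.conj : C^o -> C^o).
Proof.
move=> x.
have /cvgrPdist_lt h : (id : C^o -> C^o) @ nbhs (x : C^o) --> (x : C^o).
  exact: cvg_id.
suff : (Num.conj : C^o -> C^o) @ nbhs (x : C^o) --> (Num.conj x : C^o) by [].
apply/(@cvgrPdist_lt _ C^o _ _ _ (Num.conj : C^o -> C^o) (Num.conj x : C^o)) => e e0.
apply: filterS (h e e0) => y.
by rewrite -rmorphB norm_conjC.
Qed.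

(** A null set contains no interval, so the points where [P] holds are dense. *)
Lemma ae_continuous_eq0 (P : R -> Prop) (g : R -> C^o) :
    {ae lebesgue_measure, forall t, P t} -> continuous g ->
    (forall t, P t -> g t = 0) ->
  forall t, g t = 0.
Proof.
move=> [N [mN N0 PN]] gc Pg t; apply: contrapT => /eqP gt0.
have gp : 0 < `|g t| by rewrite normr_gt0.
have : nbhs t [set u | g u != 0].
  have /cvgrPdist_lt /(_ _ gp) := gc t; apply: filterS => u.
  by apply: contraTneq => ->; rewrite subr0 ltxx.
case/nbhs_ballP => e /= e0 sub.
have IN : [set` `]t - e, t + e[] `<=` N.
  move=> u; rewrite /= in_itv /= => /andP [u1 u2]; apply: PN => Pu.
  have : ball t e u by rewrite /ball /= ltr_norml; apply/andP; split; lra.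
  by move/sub => /=; rewrite (Pg _ Pu) eqxx.
have : (lebesgue_measure ([set` `](t - e)%R, (t + e)%R[] : set R) <= 0 :> \bar R)%E.
  have IN' : (lebesgue_measure [set` `](t - e)%R, (t + e)%R[] <= lebesgue_measure N)%E.
    by apply: le_measure => //; rewrite inE //; exact: measurable_itv.
  by apply: le_trans IN' _; rewrite N0.
rewrite lebesgue_measure_itv /= lte_fin.
have -> : t - e < t + e by lra.
by rewrite -EFinD lee_fin; lra.
Qed.

End Calculus.

(** * Structure of rational inner and Gamma-inner functions *)

Section InnerStructure.
Variable R : realType.
Local Notation C := R[i].
Implicit Types (P Q : {poly C}) (z : C) (f s p : {fraction {poly C}}) (N : nat).

Lemma zero_free_rden f (K : C) : 0 <= K ->
  (forall z, `|z| < 1 -> `|reval f z| <= K) -> zero_free (rden f).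
Proof.
by move=> K0; apply: bounded_fraction_zero_free => //;
  [exact: coprimep_rnum_rden | exact: rden_neq0].
Qed.

(** Boundedness excludes poles in the closed disc, after which [inner_fraction]
    applies to the lowest terms. *)
Lemma inner_crev f : (forall z, `|z| < 1 -> `|reval f z| <= 1) ->
    (forall z, `|z| = 1 -> `|reval f z| = 1) ->
  exists Q, [/\ (size Q <= (rdegree f).+1)%N, zero_free Q &
    f = (crev (rdegree f) Q)%:F / Q%:F].
Proof.
move=> f1 fT; have dz := zero_free_rden ler01 f1.
have [] := inner_fraction (coprimep_rnum_rden f) dz.
  move=> z z1; have d0 : (rden f).[z] != 0 by rewrite dz ?z1.
  have := fT z z1; rewrite /reval normf_div => /(canRL (mulfVK _)).
  by rewrite mul1r normr_eq0; apply.
move=> m [m0 e]; exists (m *: rden f).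
have d0 : (rden f)%:F != 0 :> {fraction {poly C}} by rewrite tofrac_eq0 rden_neq0.
have m0' : (m%:P)%:F != 0 :> {fraction {poly C}} by rewrite tofrac_eq0 polyC_eq0.
split.
- rewrite size_scale // /rdegree prednK ?leq_maxr //.
  by rewrite leq_max orbC size_poly_gt0 rden_neq0.
- by move=> z z1; rewrite hornerZ mulf_neq0 // dz.
- rewrite e -!mul_polyC !tofracM -mulf_div divff // mul1r; exact: rnum_rdenE.
Qed.

Lemma reval_crev_circle f N Q (c : C) z : (size Q <= N.+1)%N -> zero_free Q ->
  `|c| = 1 -> f = (c *: crev N Q)%:F / Q%:F -> `|z| = 1 -> `|reval f z| = 1.
Proof.
move=> sQ Qz c1 fE z1; have Qn : Q.[z] != 0 by rewrite Qz ?z1.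
rewrite (reval_frac Qn fE) hornerZ !normrM c1 mul1r normfV crev_norm // divff //.
by rewrite normr_eq0.
Qed.

Lemma ae_mono (P P' : R -> Prop) : (forall t, P t -> P' t) ->
  {ae lebesgue_measure, forall t, P t} -> {ae lebesgue_measure, forall t, P' t}.
Proof.
exact: (@filterS _ _ (ae_filter_ringOfSetsType (@lebesgue_measure R))).
Qed.

Lemma radial_limits_circle f (P : R -> C -> Prop) : zero_free (rden f) ->
  {ae lebesgue_measure, forall t,
     exists2 l, radial_limit (reval f) (expi t) l & P t l} ->
  {ae lebesgue_measure, forall t, P t (reval f (expi t))}.
Proof.
move=> dz; apply: ae_mono => t [l fl Pl].
have dt : (rden f).[expi t] != 0 by rewrite dz ?norm_expi.
by rewrite -(radial_limit_unique dt fl).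
Qed.

Lemma continuous_reval_expi f : zero_free (rden f) ->
  continuous (fun t : R => reval f (expi t) : C^o).
Proof.
move=> dz t; have dt : (rden f).[expi t] != 0 by rewrite dz ?norm_expi.
apply: (@continuous_comp _ C^o C^o (@expi R) (reval f)).
  exact: continuous_expi.
exact: continuous_reval.
Qed.

Lemma continuous_mul_sub (a b c : R -> C^o) :
  continuous a -> continuous b -> continuous c ->
  continuous (fun t => a t * b t - c t : C^o).
Proof.
move=> ca cb cc u.
have h : (fun t => a t * b t) @ nbhs u --> (a u * b u : C^o).
  by apply: (@cvgM _ _ (nbhs u) _ a b); [exact: ca | exact: cb].
exact: (cvgB h (cc u)).
Qed.

Lemma continuous_conj_reval_expi f : zero_free (rden f) ->
  continuous (fun t : R => (reval f (expi t))^* : C^o).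
Proof.
move=> dz t.
apply: (@continuous_comp _ C^o C^o (fun t : R => reval f (expi t) : C^o)
  (Num.conj : C^o -> C^o)).
  exact: continuous_reval_expi.
exact: continuous_conj.
Qed.

Lemma ae_norm1_circle f : zero_free (rden f) ->
  {ae lebesgue_measure, forall t : R, `|reval f (expi t)| = 1} ->
  forall z, `|z| = 1 -> `|reval f z| = 1.
Proof.
move=> dz ae z z1; have [t ->] := expi_surj z1.
pose g (t : R) : C^o := reval f (expi t) * (reval f (expi t))^* - 1.
suff /eqP : g t = 0.
  by rewrite subr_eq0 -normCK sqrp_eq1 // => /eqP.
apply: (ae_continuous_eq0 ae); last first.
  by move=> u fu; rewrite /g -normCK fu expr1n subrr.
apply: continuous_mul_sub; last exact: cst_continuous.
  exact: continuous_reval_expi.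
exact: continuous_conj_reval_expi.
Qed.

Lemma rational_inner_crev f : rational_inner f ->
  exists Q, [/\ (size Q <= (rdegree f).+1)%N, zero_free Q &
    f = (crev (rdegree f) Q)%:F / Q%:F].
Proof.
case=> _ f1 fT; apply: inner_crev => //; apply: ae_norm1_circle.
  exact: zero_free_rden ler01 f1.
exact: (radial_limits_circle (P := fun _ l => `|l| = 1) (zero_free_rden ler01 f1)).
Qed.

(** The bound by 1 on the disc comes from the factorization into Blaschke
    factors. *)
Lemma crev_rational_inner f N Q (c : C) : (size Q <= N.+1)%N -> zero_free Q ->
    `|c| = 1 -> f = (c *: crev N Q)%:F / Q%:F ->
  rational_inner f /\ rdegree f = N.
Proof.
move=> sQ Qz c1 fE; have c0 := circle_neq0 c1; split; last first.
  rewrite (rdegree_frac _ _ fE) ?zero_free_neq0 ?coprimepZl ?coprimep_crev //.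
  by rewrite size_scale // size_crev_zero_free //; move/maxn_idPl: sQ => ->.
have dz z : `|z| <= 1 -> (rden f).[z] != 0.
  by move=> z1; apply: rden_nonzero fE; apply: Qz.
split.
- by move=> z z1; apply/derivable_reval/dz/ltW.
- move=> z z1; have Qn : Q.[z] != 0 by apply/Qz/ltW.
  rewrite /closed_disc /= (reval_frac Qn fE) hornerZ normf_div normrM c1 mul1r.
  rewrite ler_pdivrMr ?normr_gt0 // mul1r.
  by apply: lteifW ((blaschke_bounds sQ Qz).1 z z1).
- apply: aeW => t; exists (reval f (expi t)).
    by apply: radial_limit_reval; rewrite dz ?norm_expi.
  exact: reval_crev_circle c1 fE (norm_expi t).
Qed.

(** The strict bound in the last clause needs a nonconstant [p]: constant
    functions may have [|s| = 2] on the whole disc. *)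
Definition Gamma_fraction s p N (D E : {poly C}) :=
  [/\ (size D <= N.+1)%N /\ zero_free D, (size E <= N.+1)%N /\ crev N E = E,
      s = E%:F / D%:F /\ p = (crev N D)%:F / D%:F,
      forall z, `|z| <= 1 -> `|E.[z]| <= 2 * `|D.[z]| &
      forall z, (0 < N)%N -> `|z| < 1 -> `|E.[z]| < 2 * `|D.[z]| ].

(** The relation [s = conj s * p] holds on [b Gamma], hence almost everywhere and
    then everywhere on the circle; it lets [s] be written over the denominator
    of [p]. *)
Lemma Gamma_fractionP s p : rational_Gamma_inner s p ->
  exists N D E, Gamma_fraction s p N D E.
Proof.
case=> _ _ hG hT.
have s2 z : `|z| < 1 -> `|reval s z| <= 2.
  move=> /hG [a [b [a1 b1 [-> _]]]].
  by apply: le_trans (ler_normD _ _) _; rewrite -[2]/(1 + 1) lerD.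
have p1 z : `|z| < 1 -> `|reval p z| <= 1.
  by move=> /hG [a [b [a1 b1 [_ ->]]]]; rewrite normrM mulr_ile1.
have sz : zero_free (rden s) by apply: zero_free_rden s2; rewrite ler0n.
have pz := zero_free_rden ler01 p1.
pose good (t : R) := bGamma (reval s (expi t), reval p (expi t)).
have ae : {ae lebesgue_measure, forall t, good t}.
  apply: ae_mono hT => t [l [m [sl pm lm]]]; rewrite /good.
  rewrite -(radial_limit_unique _ sl) -?(radial_limit_unique _ pm) //.
    by rewrite pz ?norm_expi.
  by rewrite sz ?norm_expi.
have pT z : `|z| = 1 -> `|reval p z| = 1.
  apply: ae_norm1_circle => //; apply: ae_mono ae => t [a [b [a1 b1 [_ ->]]]].
  by rewrite normrM a1 b1 mulr1.
have spT z : `|z| = 1 -> reval s z = (reval s z)^* * reval p z.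
  move=> z1; have [t ->] := expi_surj z1.
  pose g (t : R) : C^o := (reval s (expi t))^* * reval p (expi t) - reval s (expi t).
  suff /subr0_eq : g t = 0 by [].
  apply: (ae_continuous_eq0 ae); last first.
    move=> u [a [b [a1 b1 [sE pE]]]]; rewrite /g sE pE rmorphD /=.
    have an := circle_neq0 a1; have bn := circle_neq0 b1.
    by rewrite (circle_conj a1) (circle_conj b1); field; rewrite an bn.
  apply: continuous_mul_sub; last exact: continuous_reval_expi.
    exact: continuous_conj_reval_expi.
  exact: continuous_reval_expi.
have [D [sD Dz pE]] := inner_crev p1 pT.
have [|E [ET sE cE]] := @common_denominator _ (rnum s) (rden s) D (rdegree p)
   (coprimep_rnum_rden s) sz Dz sD.
  move=> z z1; have Dn : D.[z] != 0 by rewrite Dz ?z1.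
  by rewrite -(reval_frac Dn pE); apply: spT.
have sE' : s = E%:F / D%:F.
  have Dn : D%:F != 0 :> {fraction {poly C}} by rewrite tofrac_eq0 zero_free_neq0.
  have dn : (rden s)%:F != 0 :> {fraction {poly C}} by rewrite tofrac_eq0 rden_neq0.
  apply: etrans (rnum_rdenE s) _; apply/eqP.
  rewrite (eqr_div _ _ dn Dn) -!tofracM ET; exact: eqxx.
have evs z : `|z| <= 1 -> E.[z] = reval s z * D.[z].
  by move=> /Dz Dn; rewrite (reval_frac Dn sE') mulfVK.
have lt1 z : `|z| < 1 -> `|E.[z]| <= 2 * `|D.[z]|.
  by move=> z1; rewrite (evs _ (ltW z1)) normrM ler_wpM2r // s2.
exists (rdegree p), D, E; split=> //.
  by move=> z z1; apply: closed_disc_le z1; rewrite ?ler0n.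
move=> z N0 z1; rewrite lt_neqAle lt1 // andbT; apply/negP => /eqP e.
have Dn : D.[z] != 0 by apply/Dz/ltW.
have Dp : 0 < `|D.[z]| by rewrite normr_gt0.
(* If [|s| = 2] in the disc, then [s] is a sum of two unimodular numbers whose
   product is [p]; but [|p| < 1]. *)
have s2' : `|reval s z| = 2.
  by apply: (mulIf (lt0r_neq0 Dp)); rewrite -normrM -(evs _ (ltW z1)).
have : `|reval p z| < 1.
  rewrite (reval_frac Dn pE) normf_div ltr_pdivrMr // mul1r.
  exact: blaschke_lt.
have [a [b [a1 b1 [sab ->]]]] := hG z z1.
have : 2 <= `|a| + `|b| by rewrite -s2' sab ler_normD.
rewrite normrM /closed_disc /= in a1 b1 * => ab2.
have ar : `|a| = 1.
  apply/eqP; rewrite eq_le a1 /= -(lerD2r `|b|); apply: le_trans ab2.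
  by rewrite -[2]/(1 + 1) lerD2l.
have br : `|b| = 1.
  apply/eqP; rewrite eq_le b1 /= -(lerD2l `|a|); apply: le_trans ab2.
  by rewrite -[2]/(1 + 1) lerD2r.
by rewrite ar br mulr1 ltxx.
Qed.

End InnerStructure.

(** * Polynomials vanishing at the nodes *)

Section Nodes.
Variable C : numClosedFieldType.
Implicit Types (D E F G P Q : {poly C}) (z : C) (N : nat).

Lemma dvdp_XsubC2 F z : root F z -> F^`().[z] = 0 -> ('X - z%:P) ^+ 2 %| F.
Proof.
move=> /factor_theorem [G ->]; rewrite derivM derivXsubC !hornerE subrr mulr0 add0r.
move=> /eqP /factor_theorem [H ->].
by rewrite -mulrA expr2 dvdp_mulIr.
Qed.

Lemma deriv_dvdp_XsubC2 F z : ('X - z%:P) ^+ 2 %| F -> F^`().[z] = 0.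
Proof.
case/dvdpP => G ->; rewrite expr2 !derivM derivXsubC.
by rewrite !(hornerXsubC, hornerM, hornerD, hornerC) subrr; ring.
Qed.

(** The zeros are [x] and its reflection [1 / conj x], which is at infinity when
    [x = 0]. *)
Definition node_factor (x : C) : {poly C} := ('X - x%:P) * (1 - x^* *: 'X).

Lemma root_reflected x z : root (1 - x^* *: 'X) z = (x^* * z == 1).
Proof. by rewrite /root !hornerE subr_eq0 eq_sym. Qed.

Lemma reflected_neq0 x : (1 - x^* *: 'X : {poly C}) != 0.
Proof.
apply/negP => /eqP /(congr1 (fun p => p.[0])); rewrite !hornerE ?mulr0 subr0.
by move/eqP; rewrite oner_eq0.
Qed.

Lemma node_factor_neq0 x : node_factor x != 0.
Proof. by rewrite mulf_neq0 ?polyXsubC_eq0 ?reflected_neq0. Qed.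

Lemma horner_node_factor x z : (node_factor x).[z] = (z - x) * (1 - x^* * z).
Proof. by rewrite /node_factor !hornerE. Qed.

Lemma node_factor_circle x z : `|z| = 1 ->
  (node_factor x).[z] = z * `|z - x| ^+ 2.
Proof.
move=> z1; rewrite horner_node_factor normCK rmorphB /= (circle_conj z1).
by field; rewrite circle_neq0.
Qed.

Lemma coprimep_node_factor x y : x != y -> `|x| <= 1 -> `|y| <= 1 ->
  coprimep (node_factor x) (node_factor y).
Proof.
move=> xy x1 y1; apply/Pdiv.ClosedField.coprimepP => z.
have cc (u v : C) : `|u| <= 1 -> `|v| <= 1 -> u^* * v = 1 -> u = v.
  move=> u1 v1 uv.
  have un : `|u| = 1.
    apply/eqP; rewrite eq_le u1 /= -[1](normr1 C) -uv normrM norm_conjC.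
    by rewrite ler_piMr.
  by rewrite (circle_conj un) in uv; rewrite -[LHS]mulr1 -uv mulVKf // circle_neq0.
have mu (u v w : C) : `|w| <= 1 -> u^* * v = 1 -> w^* * v = 1 -> u = w.
  move=> w1 uv wv; have v0 : v != 0.
    by apply: contra_eq_neq uv => ->; rewrite mulr0 eq_sym oner_eq0.
  by apply: (can_inj (@conjCK C)); apply: (mulIf v0); rewrite uv wv.
rewrite -/(root _ z) /node_factor !rootM !root_XsubC !root_reflected.
case/orP => /eqP zx; rewrite negb_or -?zx; apply/andP; split; apply: contra_neq xy.
- by rewrite zx.
- by move=> h; rewrite zx in h; apply/esym/cc.
- by move=> h; rewrite h in zx; apply: cc.
- by move=> h; apply: (mu _ z); rewrite ?h.
Qed.

Definition node_poly n (x : 'I_n -> C) : {poly C} := \prod_j node_factor (x j).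

Lemma node_poly_neq0 n (x : 'I_n -> C) : node_poly x != 0.
Proof. by apply/prodf_neq0 => j _; exact: node_factor_neq0. Qed.

Lemma node_poly_circle n (x : 'I_n -> C) z : `|z| = 1 ->
  (node_poly x).[z] = z ^+ n * \prod_j `|z - x j| ^+ 2.
Proof.
move=> z1; rewrite horner_prod; under eq_bigr do rewrite node_factor_circle //.
by rewrite big_split /= prodr_const card_ord.
Qed.

(** The node polynomial equals its own reversal with respect to the degree [2 n];
    if some [x j] is 0, its degree is smaller. *)
Lemma node_poly_conj n (x : 'I_n -> C) z : `|z| = 1 ->
  ((node_poly x).[z])^* * z ^+ n * z ^+ n = (node_poly x).[z].
Proof.
move=> z1; rewrite node_poly_circle // rmorphM rmorphXn /= circle_conj //.
have -> : (\prod_j `|z - x j| ^+ 2)^* = \prod_j `|z - x j| ^+ 2.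
  by rewrite rmorph_prod; apply: eq_bigr => j _; rewrite rmorphXn /= conj_normC.
by rewrite exprVn; field; rewrite expf_neq0 ?circle_neq0.
Qed.

(** A zero of the reversal of [F] at [x] is a zero of [F] at the reflection of
    [x]; on the circle the two coincide and a double zero is required. *)
Lemma node_factor_dvdp F m x : (size F <= m.+1)%N -> `|x| <= 1 ->
    root F x -> root (crev m F) x ->
    (`|x| = 1 -> ('X - x%:P) ^+ 2 %| F) ->
  node_factor x %| F.
Proof.
move=> sF x1 Fx cFx F2; have [xc|xn] := eqVneq `|x| 1.
  apply: dvdp_trans (F2 xc).
  have -> : node_factor x = (- x^*) *: ('X - x%:P) ^+ 2.
    apply: circle_polyP => z z1.
    rewrite horner_node_factor hornerZ expr2 hornerM hornerXsubC circle_conj //.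
    by field; rewrite circle_neq0.
  by rewrite dvdpZl // oppr_eq0 conjC_eq0 circle_neq0.
have xlt : `|x| < 1 by rewrite lt_neqAle xn.
rewrite /node_factor Gauss_dvdp; last first.
  rewrite coprimep_sym coprimep_XsubC root_reflected mulrC -normCK.
  by rewrite sqrp_eq1.
rewrite dvdp_XsubCl Fx /=.
have [x0|x0] := eqVneq x 0; first by rewrite x0 rmorph0 scale0r subr0 dvd1p.
have -> : 1 - x^* *: 'X = (- x^*) *: ('X - (x^*)^-1%:P) :> {poly C}.
  have cx : x^* != 0 by rewrite conjC_eq0.
  by apply/polyP => i; rewrite !coefE; case: (i == 0%N) => /=; field.
rewrite dvdpZl ?oppr_eq0 ?conjC_eq0 // dvdp_XsubCl.
move: cFx; rewrite /root horner_crev // mulf_eq0 expf_eq0 (negPf x0) andbF /=.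
by rewrite conjC_eq0.
Qed.

Lemma node_poly_dvdp n (x : 'I_n -> C) F m : injective x ->
    (forall j, `|x j| <= 1) -> (size F <= m.+1)%N ->
    (forall j, root F (x j)) -> (forall j, root (crev m F) (x j)) ->
    (forall j, `|x j| = 1 -> ('X - (x j)%:P) ^+ 2 %| F) ->
  node_poly x %| F.
Proof.
move=> xI x1 sF Fx cFx F2; rewrite /node_poly.
have := index_enum_uniq 'I_n; move: (index_enum _) => r.
elim: r => [|j r IH]; first by rewrite big_nil dvd1p.
rewrite big_cons /= => /andP [jr /IH rF].
rewrite Gauss_dvdp ?rF ?(node_factor_dvdp sF) // ?Fx ?cFx //; first exact: F2.
rewrite big_seq; apply: (big_ind (fun p => coprimep (node_factor (x j)) p)).
- exact: coprimep1.
- by move=> p q cp cq; rewrite coprimepMr cp.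
- move=> i ir; apply: coprimep_node_factor => //; rewrite (inj_eq xI).
  by apply: contraNneq jr => ->.
Qed.

(** On the circle the two quotients by the node polynomial are conjugate to each
    other.  So [X^g] times one of them is the reversal of the other at its
    degree [g], which leaves room for constants only. *)
Lemma node_quotient_const n (x : 'I_n -> C) F : (size F <= n.*2.+1)%N ->
    F != 0 -> node_poly x %| F -> node_poly x %| crev n.*2 F ->
  exists2 w : C, `|w| = 1 & F = w *: crev n.*2 F.
Proof.
move=> sF F0 /dvdpP [G FG] /dvdpP [H FH].
pose M := node_poly x; have M0 : M != 0 := node_poly_neq0 x.
have G0 : G != 0 by apply: contraNneq F0 => e; rewrite FG e mul0r.
pose g := (size G).-1.
have sg : size G = g.+1 by rewrite prednK // size_poly_gt0.
have e : 'X^g * H = crev g G.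
  apply: (mulIf M0); apply: circle_polyP => z z1.
  rewrite !hornerM -mulrA -[H.[z] * _]hornerM -FH crev_circle //.
  rewrite crev_circle ?sg // hornerXn FG hornerM rmorphM /=.
  by rewrite -[in RHS](node_poly_conj x z1) -addnn exprD; ring.
have H0 : H != 0.
  have : crev g G != 0.
    apply: contraNneq G0 => e0.
    by rewrite -(@crevK _ g G) ?sg // e0; apply/eqP/polyP => i;
       rewrite coef_poly !coef0 conjC0; case: ifP.
  by apply: contraNneq => H0; rewrite -e H0 mulr0.
have [h Hh] : exists h, H = h%:P.
  exists H`_0; apply: size1_polyC.
  have := size_crev g G; rewrite -e size_monicM ?monicXn // size_polyXn addSn /=.
  by rewrite -[g.+1]addn1 leq_add2l.
have h0 : h != 0 by move: H0; rewrite Hh polyC_eq0.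
have Gh : G = (h^*)%:P.
  apply: circle_polyP => z z1.
  have /(congr1 (fun p => p.[z])) := e.
  rewrite crev_circle ?sg // hornerM hornerXn Hh !hornerC.
  have zg : z ^+ g != 0 by rewrite expf_neq0 ?circle_neq0.
  by move/(mulfI zg) => ->; rewrite conjCK.
exists (h^* / h); first by rewrite normf_div norm_conjC divff // normr_eq0.
rewrite FH Hh {1}FG Gh -!mul_polyC mulrA -polyCM mulfVK //.
Qed.

Section Royal.
Variables (D E : {poly C}) (N : nat).
Hypotheses (sD : (size D <= N.+1)%N) (Dz : zero_free D).
Hypotheses (sE : (size E <= N.+1)%N) (cE : crev N E = E).
Hypothesis ED : forall z, `|z| <= 1 -> `|E.[z]| <= 2 * `|D.[z]|.

(** The numerator of [s^2 - 4 p] over [D^2]. *)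
Definition royal_poly := E ^+ 2 - 4 *: (D * crev N D).

Lemma size_royal_poly : (size royal_poly <= N.*2.+1)%N.
Proof.
rewrite /royal_poly; apply: leq_trans (size_polyD _ _) _.
rewrite size_polyN geq_max; apply/andP; split.
  by rewrite expr2 -addnn size_polyM_le.
by apply: leq_trans (size_scale_leq _ _) _; rewrite -addnn size_polyM_le ?size_crev.
Qed.

Lemma royal_poly_circle z : `|z| = 1 ->
  z ^- N * royal_poly.[z] = `|E.[z]| ^+ 2 - 4 * `|D.[z]| ^+ 2.
Proof.
move=> z1; have zN : z ^+ N != 0 by rewrite expf_neq0 ?circle_neq0.
rewrite /royal_poly hornerD hornerN hornerZ !hornerM crev_circle // !normCK.
have -> : E.[z] * E.[z] = E.[z] * (z ^+ N * (E.[z])^*).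
  by rewrite -crev_circle // cE.
by field.
Qed.

(** By [royal_poly_circle], [z ^- N * royal_poly.[z]] is nonpositive on the
    circle, and [boundary_zero_double] applies. *)
Lemma royal_poly_double z : `|z| = 1 -> root royal_poly z ->
  ('X - z%:P) ^+ 2 %| royal_poly.
Proof.
move=> z1; apply: (boundary_zero_double size_royal_poly z1) => y y1.
rewrite royal_poly_circle // subr_le0.
have -> : 4 * `|D.[y]| ^+ 2 = (2 * `|D.[y]|) ^+ 2 by ring.
by rewrite ler_pXn2r ?nnegrE ?mulr_ge0 ?ler0n // ED // y1.
Qed.

(** The royal polynomial is self-reversed with respect to the degree [2 N]. *)
Lemma crev_royal_poly z : `|z| = 1 ->
  royal_poly.[z] = z ^+ N.*2 * (royal_poly.[z])^*.
Proof.
move=> z1; have zN : z ^+ N != 0 by rewrite expf_neq0 ?circle_neq0.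
have e := royal_poly_circle z1.
have -> : royal_poly.[z] = z ^+ N * (`|E.[z]| ^+ 2 - 4 * `|D.[z]| ^+ 2).
  by rewrite -e; field.
have r : `|E.[z]| ^+ 2 - 4 * `|D.[z]| ^+ 2 \is Num.real.
  by rewrite rpredB ?rpredM ?rpredX ?normr_real ?realn.
rewrite rmorphM rmorphXn /= (CrealP r) circle_conj //.
by rewrite -addnn exprD exprVn; field.
Qed.

(** The quotient of the royal polynomial by the node polynomial has no zero in
    the closed disc by multiplicity count, hence none outside by reflection. *)
Lemma royal_degree n (x : 'I_n -> C) : injective x ->
    (forall j, `|x j| <= 1) ->
    (forall z, `|z| <= 1 -> root royal_poly z -> exists j, z = x j) ->
    (forall j, mup (x j) royal_poly = (`|x j| == 1).+1) ->
  royal_poly != 0 -> N = n.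
Proof.
move=> xI x1 xall xm R0.
have Rx j : root royal_poly (x j).
  by rewrite -dvdp_XsubCl XsubC_dvd // xm.
have cR : crev N.*2 royal_poly = royal_poly.
  apply: circle_polyP => z z1.
  by rewrite crev_circle ?size_royal_poly // -crev_royal_poly.
have : node_poly x %| royal_poly.
  apply: (node_poly_dvdp xI x1 size_royal_poly) => // [j|j xj]; first by rewrite cR.
  exact: royal_poly_double.
case/dvdpP => G RG.
have G0 : G != 0 by apply: contraNneq R0 => e; rewrite RG e mul0r.
have Gz : zero_free G.
  move=> z z1; apply/negP => Gz.
  have [|j zj] := xall z z1; first by rewrite RG rootM /root Gz.
  have := xm j; rewrite RG mupM ?node_poly_neq0 // => e.
  have : (0 < mup (x j) G)%N by rewrite -XsubC_dvd // dvdp_XsubCl /root -zj Gz.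
  have : ((`|x j|%R == 1%R).+1 <= mup (x j) (node_poly x))%N.
    rewrite mup_geq ?node_poly_neq0 //.
    apply: (@dvdp_trans _ (node_factor (x j))); last first.
      by rewrite /node_poly (bigD1 j) //= dvdp_mulIl.
    rewrite /node_factor; case: eqP => [xc|_]; last by rewrite expr1 dvdp_mulIl.
    rewrite expr2 dvdp_mul2l ?polyXsubC_eq0 // dvdp_XsubCl root_reflected.
    by rewrite mulrC -normCK xc expr1n.
  by move: e; lia.
pose g := (size G).-1.
have sg : size G = g.+1 by rewrite prednK // size_poly_gt0.
have e : 'X^(n.*2 + g) * G = 'X^(N.*2) * crev g G.
  apply: (mulIf (node_poly_neq0 x)); apply: circle_polyP => z z1.
  rewrite -mulrA -RG !hornerM crev_royal_poly // RG hornerM crev_circle ?sg //.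
  rewrite !hornerXn rmorphM /= -[in RHS](node_poly_conj x z1) -addnn !exprD.
  by ring.
have [/closed_rootP [r Gr]|/negPn/eqP sG] := boolP (size G != 1%N).
  have r1 : ~~ (`|r| <= 1) by apply: contraL Gr => /Gz.
  have r0 : r != 0 by apply: contraNneq r1 => ->; rewrite normr0 ler01.
  have : root ('X^(N.*2) * crev g G) r by rewrite -e rootM Gr orbT.
  rewrite rootM /root hornerXn expf_eq0 (negPf r0) andbF /=.
  move/(crev_root_lt1 (eq_leq sg) Gz)/ltW => rle; by rewrite rle in r1.
have g0 : g = 0%N by rewrite /g sG.
move/(congr1 (fun p : {poly C} => size p)): e.
rewrite !size_monicM ?monicXn //; last first.
  by rewrite -size_poly_eq0 size_crev_zero_free.
rewrite !size_polyXn size_crev_zero_free // sG g0 addn0 !addn1 /= => /eqP.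
rewrite eqSS => /eqP /(congr1 half); rewrite !doubleK; exact: esym.
Qed.

End Royal.
End Nodes.

(** * The functions Phi_w composed with h *)

Section RoyalFamily.
Variables (C : numClosedFieldType) (n : nat) (D E : {poly C}).
Variables (sigma eta : 'I_n -> C).
Implicit Types (z w zeta tau : C) (Q : {poly C}).
Local Notation Dt := (crev n D).

(** Numerator and denominator of the composite of [Phi_w] with
    [h = (E / D, crev D / D)]. *)
Definition Phi_num w := (2 * w) *: Dt - E.
Definition Phi_den w := 2 *: D - w *: E.

Hypotheses (n_gt0 : (0 < n)%N).
Hypotheses (sD : (size D <= n.+1)%N) (Dz : zero_free D).
Hypotheses (sE : (size E <= n.+1)%N) (cE : crev n E = E).
Hypothesis ED : forall z, `|z| <= 1 -> `|E.[z]| <= 2 * `|D.[z]|.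
Hypothesis EDlt : forall z, `|z| < 1 -> `|E.[z]| < 2 * `|D.[z]|.
Hypotheses (sigmaI : injective sigma) (sigma1 : forall j, `|sigma j| <= 1).
Hypothesis R0 : royal_poly D E n != 0.
Hypothesis royal_sigma :
  forall z, `|z| <= 1 -> root (royal_poly D E n) z -> exists j, z = sigma j.
Hypothesis Esigma : forall j, E.[sigma j] = - 2 * eta j * D.[sigma j].
Hypothesis Dsigma : forall j, Dt.[sigma j] = eta j ^+ 2 * D.[sigma j].

Lemma Phi_num_crev w : `|w| = 1 -> Phi_num w = w *: crev n (Phi_den w).
Proof.
move=> w1; have w0 := circle_neq0 w1.
rewrite /Phi_den crevD crevN !crevZ cE conjC_nat circle_conj //.
by rewrite scalerBr !scalerA mulfV // scale1r [w * 2]mulrC.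
Qed.

Lemma size_Phi_den w : (size (Phi_den w) <= n.+1)%N.
Proof.
rewrite (leq_trans (size_polyD _ _)) // size_polyN geq_max.
by rewrite !(leq_trans (size_scale_leq _ _)).
Qed.

Lemma size_Phi_num w : (size (Phi_num w) <= n.+1)%N.
Proof.
rewrite (leq_trans (size_polyD _ _)) // size_polyN geq_max.
by rewrite !(leq_trans (size_scale_leq _ _)) // size_crev.
Qed.

Lemma horner_Phi_den w z : (Phi_den w).[z] = 2 * D.[z] - w * E.[z].
Proof. by rewrite /Phi_den hornerD hornerN !hornerZ. Qed.

Lemma horner_Phi_num w z : (Phi_num w).[z] = 2 * w * Dt.[z] - E.[z].
Proof. by rewrite /Phi_num hornerD hornerN !hornerZ. Qed.

Lemma Phi_den_disc w z : `|w| = 1 -> `|z| < 1 -> (Phi_den w).[z] != 0.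
Proof.
move=> w1 z1; rewrite horner_Phi_den subr_eq0.
apply: contraTneq (EDlt z1) => /(congr1 (fun x => `|x|)).
by rewrite !normrM w1 mul1r normr_nat => ->; rewrite ltxx.
Qed.

Lemma Phi_den_neq0 w : `|w| = 1 -> Phi_den w != 0.
Proof.
move=> w1; have := @Phi_den_disc w 0 w1; rewrite normr0 ltr01 => /(_ isT).
by apply: contraNneq => ->; rewrite horner0.
Qed.

(** On the circle [|s| = 2] means that the royal polynomial vanishes. *)
Lemma circle_lt2 z : `|z| = 1 -> (forall j, `|sigma j| = 1 -> z != sigma j) ->
  `|E.[z]| < 2 * `|D.[z]|.
Proof.
move=> z1 zs; rewrite lt_neqAle ED ?z1 // andbT; apply/negP => /eqP e.
have rz : root (royal_poly D E n) z.
  have := royal_poly_circle sD sE cE z1; rewrite e.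
  have -> : (2 * `|D.[z]|) ^+ 2 - 4 * `|D.[z]| ^+ 2 = 0 by ring.
  move/eqP; rewrite mulf_eq0 invr_eq0 expf_eq0 (negPf (circle_neq0 z1)) andbF.
  by [].
have [|j zj] := royal_sigma _ rz; first by rewrite z1.
by have := zs j; rewrite -zj z1 eqxx => /(_ erefl).
Qed.

(** A zero [z] of the denominator satisfies [w s(z) = 2], so it is a boundary
    node, where [s = - 2 eta j]. *)
Lemma Phi_den_zero_free w : `|w| = 1 ->
  (forall j, `|sigma j| = 1 -> 1 + w * eta j != 0) -> zero_free (Phi_den w).
Proof.
move=> w1 we z; rewrite le_eqVlt => /orP [/eqP z1|]; last exact: Phi_den_disc.
case: (pselect (forall j, `|sigma j| = 1 -> z != sigma j)) => [zs|zs].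
  rewrite horner_Phi_den subr_eq0.
  apply: contraTneq (circle_lt2 z1 zs) => /(congr1 (fun x => `|x|)).
  by rewrite !normrM w1 mul1r normr_nat => ->; rewrite ltxx.
have [j sj] : exists j, z = sigma j.
  apply: contrapT => h; apply: zs => j _; apply/eqP => zj; apply: h; by exists j.
rewrite horner_Phi_den sj Esigma.
have -> : 2 * D.[sigma j] - w * (- 2 * eta j * D.[sigma j])
   = 2 * D.[sigma j] * (1 + w * eta j) by ring.
by rewrite !mulf_neq0 ?pnatr_eq0 ?Dz ?we // -sj.
Qed.

Lemma Phi_sigma w j : (Phi_num w).[sigma j] = eta j * (Phi_den w).[sigma j].
Proof. by rewrite horner_Phi_num horner_Phi_den Esigma Dsigma; ring. Qed.

Lemma Dsigma_neq0 j : D.[sigma j] != 0.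
Proof. exact: Dz. Qed.

Lemma norm_eta j : `|sigma j| = 1 -> `|eta j| = 1.
Proof.
move=> s1; have := crev_norm sD s1; rewrite Dsigma normrM normrX.
move/(canRL (mulfK _)); rewrite divff ?normr_eq0 ?Dsigma_neq0 // => /(_ isT) /eqP.
by rewrite sqrp_eq1 // => /eqP.
Qed.

Lemma norm_eta_lt1 j : `|sigma j| < 1 -> `|eta j| < 1.
Proof.
move=> s1; have := blaschke_lt n_gt0 sD Dz s1; rewrite Dsigma normrM normrX.
rewrite -[X in _ < X]mul1r ltr_pM2r ?normr_gt0 ?Dsigma_neq0 //.
by rewrite expr_lt1.
Qed.

(** At a boundary node the royal polynomial has a double zero, so its derivative
    ties [s'] to [p'] there. *)
Lemma derivE_sigma j : `|sigma j| = 1 ->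
  E^`().[sigma j] = - (eta j * D^`().[sigma j] + Dt^`().[sigma j] / eta j).
Proof.
move=> s1; have e0 := circle_neq0 (norm_eta s1); have d0 := Dsigma_neq0 j.
have r : root (royal_poly D E n) (sigma j).
  rewrite /root /royal_poly hornerD hornerN hornerZ expr2 !hornerM Esigma Dsigma.
  by apply/eqP; ring.
have := deriv_dvdp_XsubC2 (royal_poly_double sD sE cE ED s1 r).
rewrite /royal_poly derivB derivZ expr2 !derivM.
rewrite hornerD hornerN hornerZ !(hornerD, hornerM) Esigma Dsigma => h.
have : -4 * eta j * D.[sigma j] * (E^`().[sigma j]
   + (eta j * D^`().[sigma j] + Dt^`().[sigma j] / eta j)) = 0.
  by rewrite -[RHS]h; field.
move/eqP; rewrite !mulf_eq0 oppr_eq0 pnatr_eq0 (negPf e0) (negPf d0) /=.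
by rewrite addr_eq0 => /eqP.
Qed.

(** By [derivE_sigma], [s' = - p' / eta j] at a boundary node; this makes the
    logarithmic derivative of [Phi_w] half that of [p], whatever [w]. *)
Lemma log_phasar_Phi w j : `|sigma j| = 1 -> 1 + w * eta j != 0 ->
  log_phasar (Phi_num w) (Phi_den w) (sigma j)
    = 2^-1 * log_phasar Dt D (sigma j).
Proof.
move=> s1 we; have e0 := circle_neq0 (norm_eta s1); have d0 := Dsigma_neq0 j.
rewrite /log_phasar horner_Phi_num horner_Phi_den /Phi_num /Phi_den.
rewrite !derivB !derivZ !hornerD !hornerN !hornerZ derivE_sigma // Esigma Dsigma.
have -> : 2 * w * (eta j ^+ 2 * D.[sigma j]) - - 2 * eta j * D.[sigma j]
   = 2 * eta j * D.[sigma j] * (1 + w * eta j) by ring.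
have -> : 2 * D.[sigma j] - w * (- 2 * eta j * D.[sigma j])
   = 2 * D.[sigma j] * (1 + w * eta j) by ring.
by field; rewrite e0 d0 we.
Qed.

(** The function [w = (2 phi + s) / (2 p + phi s)] is unimodular on the circle;
    its numerator and its denominator share the [2 n] zeros of the node
    polynomial, and so it is constant. *)
Lemma solution_Phi Q : (size Q <= n.+1)%N -> zero_free Q ->
    (forall j, (crev n Q).[sigma j] = eta j * Q.[sigma j]) ->
    (forall j, `|sigma j| = 1 -> log_phasar (crev n Q) Q (sigma j)
       = 2^-1 * log_phasar Dt D (sigma j)) ->
  exists2 w, `|w| = 1 & crev n Q * Phi_den w = Phi_num w * Q.
Proof.
move=> sQ Qz Qs Ql; pose Qt := crev n Q.
pose F := 2 *: (Qt * D) + E * Q; pose Ft := 2 *: (Q * Dt) + E * Qt.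
have sQt : (size Qt <= n.+1)%N := size_crev n Q.
have sF : (size F <= n.*2.+1)%N.
  rewrite (leq_trans (size_polyD _ _)) // geq_max -addnn size_polyM_le // andbT.
  by rewrite (leq_trans (size_scale_leq _ _)) // size_polyM_le.
have cF : crev n.*2 F = Ft.
  rewrite /F /Ft crevD crevZ conjC_nat -addnn !crevM // cE crevK //.
have cFt : crev n.*2 Ft = F by rewrite -cF crevK.
have sFt : (size Ft <= n.*2.+1)%N by rewrite -cF size_crev.
have Fs j : root F (sigma j).
  rewrite /root /F hornerD hornerZ !hornerM Esigma /Qt Qs; apply/eqP; ring.
have Fts j : root Ft (sigma j).
  rewrite /root /Ft hornerD hornerZ !hornerM Esigma /Qt Qs Dsigma; apply/eqP; ring.
(* The condition on phasar derivatives, cleared of denominators; it says that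
   the derivatives of [F] and [Ft] vanish at the boundary nodes. *)
have key j : `|sigma j| = 1 ->
    2 * D.[sigma j] * (Qt^`().[sigma j] - eta j * Q^`().[sigma j])
    = Q.[sigma j] * (Dt^`().[sigma j] / eta j - eta j * D^`().[sigma j]).
  move=> s1; have e0 := circle_neq0 (norm_eta s1); have d0 := Dsigma_neq0 j.
  have q0 : Q.[sigma j] != 0 := Qz _ (sigma1 j); have s0 := circle_neq0 s1.
  have := Ql j s1; rewrite /log_phasar Qs Dsigma -/Qt => h.
  have := congr1 (fun x => 2 * D.[sigma j] * eta j * Q.[sigma j] / sigma j * x) h.
  move=> {}h; apply: etrans (etrans _ h) _; field; rewrite ?e0 ?d0 ?q0 ?s0 //.
have F2 j : `|sigma j| = 1 -> ('X - (sigma j)%:P) ^+ 2 %| F.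
  move=> s1; apply: dvdp_XsubC2; first exact: Fs.
  have e0 := circle_neq0 (norm_eta s1).
  rewrite /F derivD derivZ !derivM !(hornerD, hornerZ, hornerM) Esigma -/Qt Qs.
  rewrite derivE_sigma //; rewrite -[RHS](subrr (2 * D.[sigma j] *
    (Qt^`().[sigma j] - eta j * Q^`().[sigma j]))) [X in _ - X]key //.
  by field.
have Ft2 j : `|sigma j| = 1 -> ('X - (sigma j)%:P) ^+ 2 %| Ft.
  move=> s1; apply: dvdp_XsubC2; first exact: Fts.
  have e0 := circle_neq0 (norm_eta s1).
  rewrite /Ft derivD derivZ !derivM !(hornerD, hornerZ, hornerM) Esigma -/Qt Qs.
  rewrite Dsigma derivE_sigma //.
  rewrite -[RHS](mulr0 (- eta j)) -[in RHS](subrr (2 * D.[sigma j] *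
    (Qt^`().[sigma j] - eta j * Q^`().[sigma j]))) [X in _ - X]key //.
  by field.
(* [F = 0] would mean [s = - 2 phi], and then [Ft = 0] gives [p = phi^2], so that
   [h] would lie in the royal variety. *)
have F0 : F != 0.
  apply/negP => /eqP F0; have Ft0 : Ft = 0.
    by apply/polyP => i; rewrite -cF F0 coef_poly !coef0 conjC0; case: ifP.
  have Q0 := zero_free_neq0 Qz.
  have Qt0 : Qt != 0 by rewrite -size_poly_eq0 size_crev_zero_free.
  move/negP: R0; apply; apply/eqP; apply: (mulIf Q0); apply: (mulIf Qt0).
  have e1 : E * Q = - (2 *: (Qt * D)) by apply/eqP; rewrite -addr_eq0 addrC -/F F0.
  have e2 : E * Qt = - (2 *: (Q * Dt)) by apply/eqP; rewrite -addr_eq0 addrC -/Ft Ft0.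
  have -> : royal_poly D E n * Q * Qt
     = (E * Q) * (E * Qt) - 4 *: (D * Dt) * Q * Qt by rewrite /royal_poly; ring.
  have e4 : 4%:P = 2%:P * 2%:P :> {poly C} by rewrite -polyCM -natrM.
  by rewrite e1 e2 -!mul_polyC e4; ring.
have MF : node_poly sigma %| F.
  by apply: (node_poly_dvdp sigmaI sigma1 sF) => // j; rewrite cF.
have MFt : node_poly sigma %| crev n.*2 F.
  by rewrite cF; apply: (node_poly_dvdp sigmaI sigma1 sFt) => // j; rewrite cFt.
have [w w1 Fw] := node_quotient_const sF F0 MF MFt.
exists w => //.
move: Fw; rewrite cF /F /Ft /Phi_den /Phi_num -/Qt -!mul_polyC polyCM => /eqP.
rewrite -subr_eq0 => /eqP h; apply/eqP; rewrite -subr_eq0 -[X in _ == X]h; apply/eqP.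
by ring.
Qed.

End RoyalFamily.

(** * Counting royal nodes *)

Section RoyalNodes.
Variable R : realType.
Local Notation C := R[i].
Variables (s p : {fraction {poly C}}) (N : nat) (D E : {poly C}).
Hypothesis h : Gamma_fraction s p N D E.
Local Notation Rp := (royal_poly D E N).

Lemma royal_variety_root z : `|z| <= 1 ->
  royal_variety (reval s z, reval p z) <-> root Rp z.
Proof.
case: h => [[sD Dz] _ [sE pE] _ _] z1; have Dn := Dz z z1.
rewrite (reval_frac Dn sE) (reval_frac Dn pE).
rewrite /root /royal_poly hornerD hornerN hornerZ expr2 !hornerM subr_eq0.
split=> [[w [e1 e2]]|/eqP e].
  have -> : E.[z] = 2 * w * D.[z] by rewrite -e1 mulfVK.
  have -> : (crev N D).[z] = w ^+ 2 * D.[z] by rewrite -e2 mulfVK.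
  by apply/eqP; ring.
exists (E.[z] / (2 * D.[z])); congr pair; first by field.
have -> : (crev N D).[z] = E.[z] * E.[z] / (4 * D.[z]) by rewrite e; field.
by field.
Qed.

Lemma royal_fraction : s ^+ 2 - 4 * p = Rp%:F / (D ^+ 2)%:F.
Proof.
case: h => [[sD Dz] _ [sE pE] _ _].
have Dn : D%:F != 0 :> {fraction {poly C}} by rewrite tofrac_eq0 zero_free_neq0.
have e4 : (4%:P)%:F = 4 :> {fraction {poly C}}.
  by rewrite -[4]/(4%:R) polyCMn tofracMn tofrac1.
have discr (F : fieldType) (d e c : F) : d != 0 ->
    (e / d) ^+ 2 - 4 * (c / d) = (e * e - 4 * (d * c)) / (d * d).
  by move=> d0; field.
rewrite sE pE (discr _ _ _ _ Dn).
by rewrite /royal_poly -mul_polyC !expr2 tofracB !tofracM e4.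
Qed.

Lemma royal_poly_neq0 :
  ~ (forall z, disc z -> royal_variety (reval s z, reval p z)) -> Rp != 0.
Proof.
move=> nr; apply: contra_not_neq nr => R0 z /ltW z1.
by apply/royal_variety_root => //; rewrite R0 root0.
Qed.

(** Each royal node counts at least 1, on the circle because zeros of the royal
    polynomial are at least double there; so [n] distinct nodes exhaust the
    total [n]. *)
Lemma royal_nodes_simple n k (sigma : 'I_n -> C) : Rp != 0 ->
    has_type n k s p -> injective sigma ->
    (forall j, royal_nodes s p (sigma j)) ->
    (forall j : 'I_n, (j < k)%N -> circle (sigma j)) ->
  [/\ forall z, `|z| <= 1 -> root Rp z -> exists j, z = sigma j,
      forall j, mup (sigma j) Rp = (`|sigma j| == 1).+1 &
      forall j : 'I_n, (j < k)%N = (`|sigma j| == 1)].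
Proof.
move=> R0 [sum_n sum_k] sI sR sT.
have [[sD Dz] [sE cE] _ ED _] := h.
have [r0 r0E] := closed_field_poly_normal Rp.
pose rs := [seq z <- undup r0 | `|z| <= 1].
have rs_uniq : uniq rs by rewrite filter_uniq // undup_uniq.
have rsP z : (z \in rs) = (`|z| <= 1) && root Rp z.
  by rewrite mem_filter mem_undup r0E rootZ ?lead_coef_eq0 // root_prod_XsubC.
have nodesE : royal_nodes s p = [set` rs].
  apply/seteqP; split=> z /=.
    by case=> z1 /(royal_variety_root z1) zr; rewrite rsP zr andbT.
  by rewrite rsP => /andP [z1 zr]; split => //; apply/royal_variety_root.
pose m := royal_multiplicity s p.
have mE z : `|z| <= 1 ->
    m z = if `|z| == 1 then (mup z Rp)%:R / 2 else (mup z Rp)%:R.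
  move=> z1; rewrite /m /royal_multiplicity.
  rewrite (zero_order_frac R0 _ royal_fraction) // horner_exp expf_neq0 //.
  exact: Dz.
have m1 z : z \in rs -> 1 <= m z.
  rewrite rsP => /andP [z1 zr]; rewrite mE //; case: eqP => zT.
    rewrite ler_pdivlMr ?ltr0n // mul1r ler_nat mup_geq //.
    by have := royal_poly_double sD sE cE ED zT zr.
  by rewrite ler1n -XsubC_dvd // dvdp_XsubCl.
have sum_rs : \sum_(z <- rs) m z = n%:R by rewrite fsbig_seq // -nodesE.
pose sg := [seq sigma j | j <- enum 'I_n].
have sg_uniq : uniq sg by rewrite map_inj_uniq ?enum_uniq.
have sg_sub : {subset sg <= rs}.
  move=> z /mapP [j _ ->]; have [s1 sr] := sR j.
  by rewrite rsP s1; apply/royal_variety_root.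
have sz : size sg = n by rewrite size_map size_enum_ord.
have one_rs : (size rs)%:R = \sum_(z <- rs) 1 :> rat by rewrite -sum1_size natr_sum.
have size_rs : (size rs <= size sg)%N.
  by rewrite sz -(ler_nat rat) -sum_rs one_rs big_seq [X in _ <= X]big_seq ler_sum.
have [szE rs_sg] := uniq_min_size sg_uniq sg_sub size_rs.
have m_eq1 z : z \in rs -> m z = 1.
  have /eqP : \sum_(z <- rs | z \in rs) (m z - 1) = 0.
    by rewrite -big_seq sumrB sum_rs -one_rs -szE sz subrr.
  rewrite psumr_eq0 => [/allP all0 zr|y yr]; last by rewrite subr_ge0 m1.
  by have := all0 z zr; rewrite zr subr_eq0 => /eqP.
have sg_in j : sigma j \in rs by rewrite -rs_sg map_f // mem_enum.
have sumT : \sum_(z <- rs | `|z| == 1) m z = k%:R.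
  have -> : \sum_(z <- rs | `|z| == 1) m z
      = \sum_(z \in [set` [seq z <- rs | `|z| == 1]]) m z.
    by rewrite -fsbig_seq; [rewrite big_filter | exact: filter_uniq].
  rewrite -sum_k.
  suff -> : royal_nodes s p `&` @circle R = [set` [seq z <- rs | `|z| == 1]] by [].
  apply/seteqP; split=> z; rewrite /= mem_filter nodesE.
    by move=> [zr z1]; rewrite zr andbT; apply/eqP.
  by move=> /andP [/eqP z1 zr].
have cardT : #|[pred j | `|sigma j| == 1]| = k.
  apply/eqP; rewrite -(eqr_nat rat) -sumT.
  rewrite (perm_big sg) /=; last by rewrite uniq_perm // => z; rewrite -rs_sg.
  rewrite big_map big_enum_cond /= (eq_bigr (fun=> 1)) => [|j _]; last exact: m_eq1.
  by rewrite -sum1_card natr_sum.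
have kn : (k <= n)%N by rewrite -cardT (leq_trans (max_card _)) // card_ord.
have cardk : #|[pred j : 'I_n | (j < k)%N]| = k.
  by rewrite -sum1_card -(big_ord_widen n (fun=> 1%N)) // sum1_card card_ord.
split.
- move=> z z1 zr; have : z \in rs by rewrite rsP z1.
  by rewrite -rs_sg => /mapP [j _ ->]; exists j.
- move=> j; have s1 : `|sigma j| <= 1 by have [] := sR j.
  have := m_eq1 _ (sg_in j); rewrite mE //; case: eqP => _.
    move/(canRL (mulfVK _)) => /(_ isT) /eqP.
    by rewrite mul1r eqr_nat => /eqP.
  by move/eqP; rewrite -[1]/(1%:R) eqr_nat => /eqP.
- have /subset_cardP/(_ _) e := etrans cardk (esym cardT).
  move=> j; have := e _ j; rewrite !inE; apply.
  by apply/fintype.subsetP => i; rewrite !inE => /sT /eqP.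
Qed.

End RoyalNodes.

(** * The change of parameter on the circle *)

Section Moebius.
Variables (C : numClosedFieldType) (s0 p0 : C).
Implicit Types (w zeta : C).
Hypotheses (p01 : `|p0| = 1) (s0E : s0 = s0^* * p0) (s02 : `|s0| < 2).

(** The relation [zeta = Phi_w (s0, p0)], solved for [w]. *)
Definition moebius zeta := (2 * zeta + s0) / (2 * p0 + zeta * s0).
(** This is [Phi_w (s0, p0)]. *)
Definition moebius_inv w := (2 * w * p0 - s0) / (2 - w * s0).

Lemma conj_s0 : s0^* = s0 / p0.
Proof. by rewrite {2}s0E mulfK ?circle_neq0. Qed.

Lemma moebius_den zeta : `|zeta| = 1 -> 2 * p0 + zeta * s0 != 0.
Proof.
move=> z1; rewrite addr_eq0; apply: contraTneq s02 => /(congr1 (fun x => `|x|)).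
by rewrite normrN !normrM z1 p01 mul1r mulr1 normr_nat => <-; rewrite ltxx.
Qed.

Lemma moebius_inv_den w : `|w| = 1 -> 2 - w * s0 != 0.
Proof.
move=> w1; rewrite subr_eq0; apply: contraTneq s02 => /(congr1 (fun x => `|x|)).
by rewrite !normrM w1 mul1r normr_nat => <-; rewrite ltxx.
Qed.

Lemma norm_moebius zeta : `|zeta| = 1 -> `|moebius zeta| = 1.
Proof.
move=> z1; have d0 := moebius_den z1.
have z0 := circle_neq0 z1; have q0 := circle_neq0 p01.
have e : (2 * zeta + s0)^* = (2 * p0 + zeta * s0) / (zeta * p0).
  rewrite rmorphD rmorphM /= conj_s0 conjC_nat (circle_conj z1).
  by field; rewrite z0 q0.
rewrite /moebius normf_div -norm_conjC e normf_div normrM z1 p01 mulr1 divr1.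
by rewrite divff // normr_eq0.
Qed.

Lemma norm_moebius_inv w : `|w| = 1 -> `|moebius_inv w| = 1.
Proof.
move=> w1; have d0 := moebius_inv_den w1.
have w0 := circle_neq0 w1; have q0 := circle_neq0 p01.
have e : (2 - w * s0)^* = (2 * w * p0 - s0) / (w * p0).
  rewrite rmorphB rmorphM /= conj_s0 conjC_nat (circle_conj w1).
  by field; rewrite w0 q0.
rewrite /moebius_inv normf_div -[X in _ / X]norm_conjC e normf_div normrM w1 p01.
rewrite mulr1 divr1 divff // normr_eq0.
have := d0; rewrite -conjC_eq0 e mulf_eq0 negb_or => /andP [].
by [].
Qed.

Lemma moebiusP zeta w : `|zeta| = 1 ->
  zeta * (2 - w * s0) = 2 * w * p0 - s0 -> w = moebius zeta.
Proof.
move=> z1 e; have d0 := moebius_den z1.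
apply: (mulIf d0); rewrite /moebius mulfVK //.
by apply/eqP; rewrite -subr_eq0 -(subrr (zeta * (2 - w * s0))) {1}e; apply/eqP; ring.
Qed.

Lemma moebius_invK w : `|w| = 1 -> moebius (moebius_inv w) = w.
Proof.
move=> w1; apply/esym/moebiusP; first exact: norm_moebius_inv.
by rewrite /moebius_inv mulfVK ?moebius_inv_den.
Qed.

Lemma moebiusK zeta : `|zeta| = 1 -> moebius_inv (moebius zeta) = zeta.
Proof.
move=> z1; have d0 := moebius_den z1.
have w1 := norm_moebius z1; have i0 := moebius_inv_den w1.
apply: (mulIf i0); rewrite /moebius_inv mulfVK //.
by move: i0; rewrite /moebius => i0; field.
Qed.

End Moebius.

Section Parametrization.
Variables (C : numClosedFieldType) (n : nat) (D E : {poly C}) (s0 p0 e : C).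
Implicit Types (w zeta tau z : C).
Local Notation Dt := (crev n D).

(** The coefficients obtained by substituting [w = moebius zeta] in [Phi_w];
    the scalar [e] is there to normalise them at [tau]. *)
Definition par_a := e *: (4 *: Dt - s0 *: E).
Definition par_b := e *: ((2 * s0) *: Dt - (2 * p0) *: E).
Definition par_c := e *: ((2 * s0) *: D - 2 *: E).
Definition par_d := e *: ((4 * p0) *: D - s0 *: E).

Lemma par_num zeta : 2 * p0 + zeta * s0 != 0 ->
  zeta *: par_a + par_b
    = (e * (2 * p0 + zeta * s0)) *: Phi_num n D E (moebius s0 p0 zeta).
Proof.
move=> d0; rewrite /par_a /par_b /Phi_num /moebius.
apply/polyP => i; rewrite !(coefD, coefN, coefZ); by field.
Qed.

Lemma par_den zeta : 2 * p0 + zeta * s0 != 0 ->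
  zeta *: par_c + par_d
    = (e * (2 * p0 + zeta * s0)) *: Phi_den D E (moebius s0 p0 zeta).
Proof.
move=> d0; rewrite /par_c /par_d /Phi_den /moebius.
apply/polyP => i; rewrite !(coefD, coefN, coefZ); by field.
Qed.

Lemma par_linear_relation :
  s0 *: par_a - 2 *: par_b + (2 * p0) *: par_c - s0 *: par_d = 0.
Proof.
apply/polyP => i; rewrite /par_a /par_b /par_c /par_d.
by rewrite !(coefD, coefN, coefZ, coef0); ring.
Qed.

Lemma par_E : (2 * p0) *: par_c - s0 *: par_d = (e * (s0 ^+ 2 - 4 * p0)) *: E.
Proof.
apply/polyP => i; rewrite /par_c /par_d.
by rewrite !(coefD, coefN, coefZ); ring.
Qed.

Lemma par_D : s0 *: par_c - 2 *: par_d = (2 * (e * (s0 ^+ 2 - 4 * p0))) *: D.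
Proof.
apply/polyP => i; rewrite /par_c /par_d.
by rewrite !(coefD, coefN, coefZ); ring.
Qed.

Lemma par_Dt :
  - (2 * p0) *: par_a + s0 *: par_b = (2 * (e * (s0 ^+ 2 - 4 * p0))) *: Dt.
Proof.
apply/polyP => i; rewrite /par_a /par_b.
by rewrite !(coefD, coefN, coefZ); ring.
Qed.

Lemma par_c_le_d z : `|p0| = 1 -> s0 = s0^* * p0 -> `|s0| < 2 ->
  `|E.[z]| <= 2 * `|D.[z]| -> `|par_c.[z]| <= `|par_d.[z]|.
Proof.
move=> p01 s0E s02 ED; have q0 := circle_neq0 p01.
rewrite /par_c /par_d 2!hornerZ !normrM ler_wpM2l //.
rewrite !hornerD !hornerN !hornerZ -(ler_pXn2r (n := 2)) ?nnegrE // -subr_ge0.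
(* The mixed terms cancel because [s0 = conj s0 * p0]. *)
have -> : `|4 * p0 * D.[z] - s0 * E.[z]| ^+ 2 - `|2 * s0 * D.[z] - 2 * E.[z]| ^+ 2
    = (4 - `|s0| ^+ 2) * ((2 * `|D.[z]|) ^+ 2 - `|E.[z]| ^+ 2).
  rewrite exprMn !normCK !rmorphB !rmorphM /= !conjC_nat (circle_conj p01).
  rewrite (conj_s0 p01 s0E); field; exact: q0.
have s04 : 0 <= 4 - `|s0| ^+ 2.
  have -> : 4 = 2 ^+ 2 :> C by ring.
  by rewrite subr_ge0 ler_pXn2r ?nnegrE ?ler0n // ltW.
rewrite mulr_ge0 // subr_ge0 ler_pXn2r ?nnegrE ?mulr_ge0 ?ler0n //.
Qed.

End Parametrization.

(** * Solutions and their normalised parametrizations *)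

Section Solutions.
Variables (R : realType) (n k : nat).
Local Notation C := R[i].
Variables (s p : {fraction {poly C}}) (sigma eta : 'I_n -> C) (D E : {poly C}).
Hypothesis n_gt0 : (0 < n)%N.
Hypothesis h : Gamma_fraction s p n D E.
Hypotheses (sigmaI : injective sigma) (sigma1 : forall j, `|sigma j| <= 1).
Hypothesis R0 : royal_poly D E n != 0.
Hypothesis royal_sigma :
  forall z, `|z| <= 1 -> root (royal_poly D E n) z -> exists j, z = sigma j.
Hypothesis circle_sigma : forall j : 'I_n, (j < k)%N = (`|sigma j| == 1).
Hypothesis Esigma : forall j, E.[sigma j] = - 2 * eta j * D.[sigma j].
Hypothesis Dsigma : forall j, (crev n D).[sigma j] = eta j ^+ 2 * D.[sigma j].
Local Notation Dt := (crev n D).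
Local Notation rho := (fun j => 2^-1 * phasar_derivative p (sigma j)).
Local Notation num := (Phi_num n D E).
Local Notation den := (Phi_den D E).

Let sD : (size D <= n.+1)%N. Proof. by case: h => [[]]. Qed.
Let Dz : zero_free D. Proof. by case: h => [[]]. Qed.
Let sE : (size E <= n.+1)%N. Proof. by case: h => [_ []]. Qed.
Let cE : crev n E = E. Proof. by case: h => [_ []]. Qed.
Let sfrac : s = E%:F / D%:F. Proof. by case: h => [_ _ []]. Qed.
Let pfrac : p = Dt%:F / D%:F. Proof. by case: h => [_ _ []]. Qed.
Let ED z : `|z| <= 1 -> `|E.[z]| <= 2 * `|D.[z]|.
Proof. by case: h => [_ _ _ H _]; apply: H. Qed.
Let EDlt z : `|z| < 1 -> `|E.[z]| < 2 * `|D.[z]|.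
Proof. by case: h => [_ _ _ _ H]; apply: H. Qed.

Lemma rho_log_phasar j : `|sigma j| = 1 ->
  rho j = 2^-1 * log_phasar Dt D (sigma j).
Proof.
move=> s1; congr (_ * _); apply: phasar_derivative_frac pfrac.
  by rewrite -normr_eq0 crev_norm // normr_eq0 Dz.
exact: Dz.
Qed.

Lemma Blaschke_dataP : Blaschke_data k sigma eta rho.
Proof.
split=> j.
- rewrite circle_sigma => /eqP s1; split=> //.
  exact: (norm_eta sD Dz sigma1 Dsigma s1).
- rewrite leqNgt circle_sigma => sn.
  have slt : `|sigma j| < 1 by rewrite lt_neqAle sn sigma1.
  split=> //; exact: (norm_eta_lt1 n_gt0 sD Dz sigma1 Dsigma slt).
- rewrite circle_sigma => /eqP s1; rewrite rho_log_phasar //.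
  by rewrite mulr_gt0 ?invr_gt0 ?ltr0n // blaschke_phasar_gt0.
Qed.

(** The denominator is free of zeros, which makes this a Blaschke product of
    degree [n]; [Phi_sigma] and [log_phasar_Phi] give the interpolation
    conditions. *)
Lemma Phi_solution w : `|w| = 1 ->
    (forall j, `|sigma j| = 1 -> 1 + w * eta j != 0) ->
  Blaschke_solution k sigma eta rho ((num w)%:F / (den w)%:F).
Proof.
move=> w1 we.
have dz := Phi_den_zero_free sD Dz sE cE ED EDlt sigma1 royal_sigma Esigma w1 we.
have [] := @crev_rational_inner R ((num w)%:F / (den w)%:F) n (den w) w
  (size_Phi_den sD sE w) dz w1.
  by rewrite -(Phi_num_crev D cE w1).
have dn j : (den w).[sigma j] != 0 := dz _ (sigma1 j).
move=> inn dg; split=> // j.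
  rewrite (reval_frac (dn j) erefl).
  by rewrite (Phi_sigma Esigma Dsigma) mulfK.
rewrite circle_sigma => /eqP s1; rewrite rho_log_phasar //.
rewrite -(log_phasar_Phi sD Dz sE cE ED sigma1 Esigma Dsigma s1 (we j s1)).
apply: phasar_derivative_frac => //.
rewrite (Phi_sigma Esigma Dsigma) mulf_neq0 //.
exact: circle_neq0 (norm_eta sD Dz sigma1 Dsigma s1).
Qed.

(** A solution is the quotient of [crev n Q] by [Q] with a zero-free [Q], to
    which [solution_Phi] applies. *)
Lemma solutionP phi : Blaschke_solution k sigma eta rho phi ->
  exists2 w, `|w| = 1 & phi = (num w)%:F / (den w)%:F.
Proof.
case=> /rational_inner_crev [Q [sQ Qz phiE]] dg val ph.
rewrite dg in sQ phiE.
have Qn j : Q.[sigma j] != 0 := Qz _ (sigma1 j).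
have Qs j : (crev n Q).[sigma j] = eta j * Q.[sigma j].
  by rewrite -val (reval_frac (Qn j) phiE) mulfVK.
have Ql j : `|sigma j| = 1 ->
    log_phasar (crev n Q) Q (sigma j) = 2^-1 * log_phasar Dt D (sigma j).
  move=> s1; rewrite -rho_log_phasar // -ph ?circle_sigma ?s1 //.
  apply/esym/phasar_derivative_frac => //.
  rewrite Qs mulf_neq0 //; exact: circle_neq0 (norm_eta sD Dz sigma1 Dsigma s1).
have [w w1 e] :=
  solution_Phi sD Dz sE cE ED sigmaI sigma1 R0 Esigma Dsigma sQ Qz Qs Ql.
exists w => //; rewrite phiE.
have Q0 : Q%:F != 0 :> {fraction {poly C}} by rewrite tofrac_eq0 zero_free_neq0.
have d0 : (den w)%:F != 0 :> {fraction {poly C}}.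
  by rewrite tofrac_eq0 (Phi_den_neq0 EDlt).
by apply/eqP; rewrite (eqr_div _ _ Q0 d0) -!tofracM e.
Qed.

(** Only finitely many [w] are excluded by [Phi_solution]. *)
Lemma exists_solution : exists phi, Blaschke_solution k sigma eta rho phi.
Proof.
have [w w1 wn] := circle_infinite [seq - (eta j)^-1 | j <- enum 'I_n].
exists ((num w)%:F / (den w)%:F); apply: Phi_solution => // j s1.
have e0 := circle_neq0 (norm_eta sD Dz sigma1 Dsigma s1).
apply: contraNneq wn => we; apply/mapP; exists j; rewrite ?mem_enum //.
by apply: (mulIf e0); rewrite mulNr mulVf //; apply/eqP; rewrite -addr_eq0 addrC we.
Qed.

Lemma Phi_of_solution phi : Blaschke_solution k sigma eta rho phi ->
  exists2 omega : C, circle omega & forall z, disc z ->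
    reval phi z = Phi omega (reval s z, reval p z).
Proof.
move=> /solutionP [w w1 ->]; exists w => // z z1.
have dn : (den w).[z] != 0 := Phi_den_disc EDlt w1 z1.
have Dn : D.[z] != 0 by apply/Dz/ltW.
rewrite (reval_frac dn erefl) (reval_frac Dn sfrac) (reval_frac Dn pfrac) /Phi /=.
move: dn; rewrite horner_Phi_num horner_Phi_den => dn.
by field; rewrite dn Dn.
Qed.

Section Tau.
Variable tau : C.
Hypothesis tau1 : `|tau| = 1.
Hypothesis tau_sigma : forall j : 'I_n, (j < k)%N -> tau != sigma j.
Local Notation s0 := (E.[tau] / D.[tau]).
Local Notation p0 := (Dt.[tau] / D.[tau]).

Definition tau_scalar := (D.[tau] * (4 * p0 - s0 ^+ 2))^-1.
Local Notation a := (par_a n D E s0 tau_scalar).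
Local Notation b := (par_b n D E s0 p0 tau_scalar).
Local Notation c := (par_c D E s0 tau_scalar).
Local Notation d := (par_d D E s0 p0 tau_scalar).

Let d0 : D.[tau] != 0. Proof. by rewrite Dz ?tau1. Qed.

Lemma tau_p0 : `|p0| = 1.
Proof. by rewrite normf_div crev_norm // divff // normr_eq0. Qed.

Lemma tau_s0 : s0 = s0^* * p0.
Proof.
have t0 : tau ^+ n != 0 by rewrite expf_neq0 ?circle_neq0.
have cd : (D.[tau])^* != 0 by rewrite conjC_eq0.
rewrite rmorphM fmorphV /= crev_circle // -{1}cE crev_circle //.
by field; rewrite d0 cd.
Qed.

Lemma tau_s02 : `|s0| < 2.
Proof.
rewrite normf_div ltr_pdivrMr ?normr_gt0 //.
apply: (circle_lt2 sD sE cE ED royal_sigma tau1) => j s1.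
by apply: tau_sigma; rewrite circle_sigma s1.
Qed.

(** The discriminant does not vanish since [|s0|^2 < 4 = |4 p0|]. *)
Lemma tau_discr_neq0 : 4 * p0 - s0 ^+ 2 != 0.
Proof.
rewrite subr_eq0; apply: contraTneq tau_s02 => /(congr1 (fun x => `|x|)).
rewrite normrM normrX tau_p0 mulr1 normr_nat.
have -> : 4 = 2 ^+ 2 :> C by ring.
move/eqP; rewrite eqrXn2 ?ler0n // => /eqP <-; by rewrite ltxx.
Qed.

Lemma par_tau : [/\ a.[tau] = 1, b.[tau] = 0, c.[tau] = 0 & d.[tau] = 1].
Proof.
have q0 := tau_discr_neq0.
rewrite /par_a /par_b /par_c /par_d /tau_scalar.
rewrite !(hornerZ, hornerD, hornerN).
have -> : Dt.[tau] = p0 * D.[tau] by rewrite mulfVK.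
have -> : E.[tau] = s0 * D.[tau] by rewrite mulfVK.
rewrite !mulfK //; move: s0 p0 q0 => x y q0.
by split; field; rewrite d0 q0.
Qed.

Lemma lft_Phi zeta : `|zeta| = 1 ->
  lft a b c d zeta = (num (moebius s0 p0 zeta))%:F / (den (moebius s0 p0 zeta))%:F.
Proof.
move=> z1; have m0 := moebius_den tau_p0 tau_s02 z1.
have w1 := norm_moebius tau_p0 tau_s0 tau_s02 z1.
rewrite /lft par_num // par_den //.
have u0 : tau_scalar * (2 * p0 + zeta * s0) != 0.
  by rewrite mulf_neq0 // invr_eq0 mulf_neq0 // tau_discr_neq0.
have uF : ((tau_scalar * (2 * p0 + zeta * s0))%:P)%:F != 0 :> {fraction {poly C}}.
  by rewrite tofrac_eq0 polyC_eq0.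
by rewrite -!mul_polyC !tofracM -mulf_div divff // mul1r.
Qed.

(** The exceptional [zeta] correspond to [w = - 1 / eta j] for the [k] boundary
    nodes. *)
Lemma par_normalised : normalised_parametrization k sigma eta rho a b c d.
Proof.
have [ta tb tc td] := par_tau.
have sZB (x y u : C) (P Q : {poly C}) : (size P <= n.+1)%N -> (size Q <= n.+1)%N ->
    (size (u *: (x *: P - y *: Q))%R <= n.+1)%N.
  move=> sP sQ; apply: leq_trans (size_scale_leq _ _) _.
  rewrite (leq_trans (size_polyD _ _)) // size_polyN geq_max.
  by rewrite !(leq_trans (size_scale_leq _ _)).
split.
- by split; apply: sZB; rewrite ?size_crev.
- exists [seq moebius_inv s0 p0 (- (eta j)^-1)
      | j <- [seq i : 'I_n <- enum 'I_n | (i < k)%N]].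
    rewrite size_map size_filter.
    have [kn|/ltnW nk] := leqP k n.
      rewrite -sum1_count big_enum_cond /= -(big_ord_widen n (fun=> 1%N)) //.
      by rewrite sum1_card card_ord.
    by apply: leq_trans (count_size _ _) _; rewrite size_enum_ord.
  move=> zeta zT zn; have z1 : `|zeta| = 1 := zT; rewrite lft_Phi //.
  have w1 := norm_moebius tau_p0 tau_s0 tau_s02 z1.
  apply: Phi_solution => //.
  move=> j s1; have e0 := circle_neq0 (norm_eta sD Dz sigma1 Dsigma s1).
  apply: contraNneq zn => we; apply/mapP; exists j.
    by rewrite mem_filter mem_enum circle_sigma s1 eqxx.
  rewrite -[LHS](moebiusK tau_p0 tau_s0 tau_s02 z1); congr moebius_inv.
  by apply: (mulIf e0); rewrite mulNr mulVf //; apply/eqP; rewrite -addr_eq0 addrC we.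
- by exists tau.
- move=> phi /solutionP [w w1 ->].
  have i1 := norm_moebius_inv tau_p0 tau_s0 tau_s02 w1.
  exists (moebius_inv s0 p0 w) => //.
  by rewrite lft_Phi // (moebius_invK tau_p0 tau_s0 tau_s02 w1).
Qed.

(** Both fractions for [phi] have degree [n] in lowest terms, and the
    normalisation at [tau] fixes both the common factor and [w]. *)
Lemma par_unique (a' b' c' d' : {poly C}) zeta :
    (size a' <= n.+1)%N -> (size b' <= n.+1)%N ->
    (size c' <= n.+1)%N -> (size d' <= n.+1)%N ->
    a'.[tau] = 1 -> d'.[tau] = 1 -> b'.[tau] = 0 -> c'.[tau] = 0 ->
    `|zeta| = 1 -> Blaschke_solution k sigma eta rho (lft a' b' c' d' zeta) ->
  zeta *: a' + b' = zeta *: a + b /\ zeta *: c' + d' = zeta *: c + d.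
Proof.
move=> sa sb sc sd ta td tb tc z1 sol.
have [w w1 e] := solutionP sol; have [_ dg _ _] := sol.
have sZ (P Q : {poly C}) : (size P <= n.+1)%N -> (size Q <= n.+1)%N ->
    (size (zeta *: P + Q)%R <= n.+1)%N.
  move=> sP sQ; rewrite (leq_trans (size_polyD _ _)) // geq_max sQ andbT.
  exact: leq_trans (size_scale_leq _ _) sP.
have nt : (zeta *: a' + b').[tau] = zeta by rewrite hornerD hornerZ ta tb; ring.
have dt : (zeta *: c' + d').[tau] = 1 by rewrite hornerD hornerZ tc td; ring.
have d'0 : zeta *: c' + d' != 0.
  by apply/eqP => e0; move: dt; rewrite e0 horner0 => /esym/eqP; rewrite oner_eq0.
have [g1 g10 [n1 d1]] :=
  fraction_proportional d'0 (erefl (lft a' b' c' d' zeta))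
    (sZ _ _ sa sb) (sZ _ _ sc sd) dg.
have [g2 g20 [n2 d2]] := fraction_proportional (Phi_den_neq0 EDlt w1) e
  (size_Phi_num D sE w) (size_Phi_den sD sE w) dg.
pose g := g1 / g2.
have n3 : zeta *: a' + b' = g *: num w.
  by rewrite n1 n2 scalerA /g mulfVK.
have d3 : zeta *: c' + d' = g *: den w.
  by rewrite d1 d2 scalerA /g mulfVK.
have Et : E.[tau] = s0 * D.[tau] by rewrite mulfVK.
have Dtt : Dt.[tau] = p0 * D.[tau] by rewrite mulfVK.
have {}dt : g * (2 * D.[tau] - w * (s0 * D.[tau])) = 1.
  by rewrite -[RHS]dt d3 hornerZ horner_Phi_den -Et.
have {}nt : g * (2 * w * (p0 * D.[tau]) - s0 * D.[tau]) = zeta.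
  by rewrite -[RHS]nt n3 hornerZ horner_Phi_num -Et -Dtt.
have wz : w = moebius s0 p0 zeta.
  apply: (moebiusP tau_p0 tau_s02 z1).
  transitivity (g * (2 * D.[tau] - w * (s0 * D.[tau])) * (2 * w * p0 - s0)).
    by rewrite -[X in X * (2 - _)]nt; ring.
  by rewrite dt mul1r.
have m0 := moebius_den tau_p0 tau_s02 z1.
have gE : g = tau_scalar * (2 * p0 + zeta * s0).
  have [_ _ tc' td'] := par_tau.
  have : (zeta *: c + d).[tau] = 1 by rewrite hornerD hornerZ tc' td'; ring.
  have dE : (den w).[tau] = 2 * D.[tau] - w * (s0 * D.[tau]).
    by rewrite horner_Phi_den -Et.
  rewrite par_den // -wz hornerZ dE -[RHS]dt.
  move=> /mulIf cancel; apply/esym/cancel.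
  by apply: contra_eq_neq dt => ->; rewrite mulr0 eq_sym oner_eq0.
by rewrite n3 d3 par_num // par_den // -wz -gE.
Qed.

(** Two nonexceptional values of [zeta] determine the four coefficients. *)
Lemma normalised_par (a' b' c' d' : {poly C}) (Z : seq C) :
    [/\ (size a' <= n.+1)%N, (size b' <= n.+1)%N, (size c' <= n.+1)%N &
        (size d' <= n.+1)%N] ->
    (forall zeta, circle zeta -> zeta \notin Z ->
       Blaschke_solution k sigma eta rho (lft a' b' c' d' zeta)) ->
    a'.[tau] = 1 /\ d'.[tau] = 1 -> b'.[tau] = 0 /\ c'.[tau] = 0 ->
  [/\ a' = a, b' = b, c' = c & d' = d].
Proof.
move=> [sa sb sc sd] sol [ta td] [tb tc].
have [z1 z11 z1n] := circle_infinite Z.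
have [z2 z21 z2n] := circle_infinite (z1 :: Z).
move: z2n; rewrite inE negb_or => /andP [z12 z2n].
have [e1 f1] := par_unique sa sb sc sd ta td tb tc z11 (sol _ z11 z1n).
have [e2 f2] := par_unique sa sb sc sd ta td tb tc z21 (sol _ z21 z2n).
have two (P Q P' Q' : {poly C}) : z1 *: P + Q = z1 *: P' + Q' ->
    z2 *: P + Q = z2 *: P' + Q' -> P = P' /\ Q = Q'.
  move=> g1 g2; have PP : P = P'.
    have z0 : z2 - z1 != 0 by rewrite subr_eq0.
    apply: (scalerI z0); rewrite !scalerBl.
    have -> : z2 *: P = z2 *: P' + Q' - Q by rewrite -g2 addrK.
    have -> : z1 *: P = z1 *: P' + Q' - Q by rewrite -g1 addrK.
    by rewrite opprB addrA subrK opprD addrACA subrr addr0.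
  by split => //; move: g1; rewrite PP => /addrI.
by have [-> ->] := two _ _ _ _ e1 e2; have [-> ->] := two _ _ _ _ f1 f2.
Qed.

Lemma par_conclusion :
  [/\ [/\ `|p0| = 1, s0 = s0^* * p0, `|s0| < 2 &
          forall z, disc z -> `|c.[z]| <= `|d.[z]|],
      s0 *: a - 2 *: b + (2 * p0) *: c - s0 *: d = 0,
      ((2 * p0) *: c - s0 *: d) ^+ 2 !=
        (- (2 * p0) *: a + s0 *: b) * (s0 *: c - 2 *: d),
      s = 2 * (((2 * p0) *: c - s0 *: d)%:F / (s0 *: c - 2 *: d)%:F) &
      p = (- (2 * p0) *: a + s0 *: b)%:F / (s0 *: c - 2 *: d)%:F].
Proof.
rewrite par_linear_relation par_E par_D par_Dt.
have : tau_scalar * (s0 ^+ 2 - 4 * p0) != 0.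
  rewrite mulf_neq0 // ?invr_eq0 ?mulf_neq0 ?tau_discr_neq0 //.
  by rewrite -oppr_eq0 opprB tau_discr_neq0.
move: (tau_scalar * (s0 ^+ 2 - 4 * p0)) => u u0.
have uF : (u%:P)%:F != 0 :> {fraction {poly C}} by rewrite tofrac_eq0 polyC_eq0.
have Dn : D%:F != 0 :> {fraction {poly C}} by rewrite tofrac_eq0 zero_free_neq0.
have twoF : (2%:P)%:F = 2 :> {fraction {poly C}}.
  by rewrite -[2]/(2%:R) polyCMn tofracMn tofrac1.
have two0 : 2 != 0 :> {fraction {poly C}}.
  by rewrite -twoF tofrac_eq0 polyC_eq0 pnatr_eq0.
have scaleF (P : {poly C}) : (u *: P)%:F = (u%:P)%:F * P%:F.
  by rewrite -mul_polyC tofracM.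
have scale2F (P : {poly C}) : ((2 * u) *: P)%:F = 2 * (u%:P)%:F * P%:F.
  by rewrite -mul_polyC polyCM !tofracM twoF.
have cancel (F : fieldType) (x y z t : F) : x != 0 -> t != 0 -> z != 0 ->
    y / z = t * ((x * y) / (t * x * z)).
  by move=> x0 t0 z0; field; rewrite z0 t0 x0.
have cancel2 (F : fieldType) (x y z t : F) : x != 0 -> t != 0 -> z != 0 ->
    y / z = (t * x * y) / (t * x * z).
  by move=> x0 t0 z0; field; rewrite z0 t0 x0.
split => //.
- split; [exact: tau_p0 | exact: tau_s0 | exact: tau_s02 |].
  move=> z z1; apply: par_c_le_d; [exact: tau_p0 | exact: tau_s0 | exact: tau_s02 |].
  exact/ED/ltW.
- apply: contraNneq R0 => e; apply/eqP.
  have u2 : (u ^+ 2)%:P != 0 :> {poly C} by rewrite polyC_eq0 expf_neq0.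
  apply: (mulfI u2); rewrite mulr0 /royal_poly mul_polyC scalerBr scalerA.
  apply/eqP; rewrite subr_eq0; apply/eqP.
  move: e; rewrite exprZn => ->; rewrite -scalerAl -scalerAr scalerA [D * _]mulrC.
  by congr (_ *: _); ring.
- rewrite sfrac scaleF scale2F; exact: cancel uF two0 Dn.
- rewrite pfrac !scale2F; exact: cancel2 uF two0 Dn.
Qed.

End Tau.
End Solutions.

(** * The theorem *)

Theorem theorem4p4 (R : realType) (n k : nat)
    (s p : {fraction {poly R[i]}}) (sigma eta : 'I_n -> R[i])
    (n_ge1 : (1 <= n)%N)
    (h_inner : rational_Gamma_inner s p)
    (h_not_royal :
       ~ (forall z, disc z -> royal_variety (reval s z, reval p z)))
    (h_type : has_type n k s p)
    (sigma_inj : injective sigma)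
    (sigma_royal : forall j, royal_nodes s p (sigma j))
    (eta_value : forall j,
       (reval s (sigma j), reval p (sigma j)) = (- 2 * eta j, eta j ^+ 2))
    (sigma_circle : forall j : 'I_n, (j < k)%N -> circle (sigma j)) :
  let rho := fun j : 'I_n => 2^-1 * phasar_derivative p (sigma j) in
  [/\ (* (1) *)
      [/\ Blaschke_data k sigma eta rho,
          exists phi, Blaschke_solution k sigma eta rho phi &
          forall phi, Blaschke_solution k sigma eta rho phi ->
            exists2 omega : R[i], circle omega &
              forall z, disc z ->
                reval phi z = Phi omega (reval s z, reval p z)],
      (* (2) *)
      exists a b c d : {poly R[i]},
        normalised_parametrization k sigma eta rho a b c d &
      (* (3) *)
      forall a b c d : {poly R[i]},
        normalised_parametrization k sigma eta rho a b c d ->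
        exists s0 p0 : R[i],
          [/\ [/\ `|p0| = 1, s0 = s0^* * p0, `|s0| < 2 &
                  forall z, disc z -> `|c.[z]| <= `|d.[z]|],
              s0 *: a - 2 *: b + (2 * p0) *: c - s0 *: d = 0,
              ((2 * p0) *: c - s0 *: d) ^+ 2 !=
                (- (2 * p0) *: a + s0 *: b) * (s0 *: c - 2 *: d),
              s = 2 * (((2 * p0) *: c - s0 *: d)%:F / (s0 *: c - 2 *: d)%:F) &
              p = (- (2 * p0) *: a + s0 *: b)%:F / (s0 *: c - 2 *: d)%:F]].
Proof.
have [N [D [E h]]] := Gamma_fractionP h_inner.
have R0 := royal_poly_neq0 h h_not_royal.
have [all_nodes simple_nodes circle_nodes] :=
  royal_nodes_simple h R0 h_type sigma_inj sigma_royal sigma_circle.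
have sigma1 j : `|sigma j| <= 1 by have [] := sigma_royal j.
have [[sD Dz] [sE cE] [sfrac pfrac] ED _] := h.
have Nn := royal_degree sD sE cE ED sigma_inj sigma1 all_nodes simple_nodes R0.
subst N.
have Esigma j : E.[sigma j] = - 2 * eta j * D.[sigma j].
  have [<- _] := eta_value j.
  by rewrite (reval_frac (Dz _ (sigma1 j)) sfrac) mulfVK // Dz.
have Dsigma j : (crev n D).[sigma j] = eta j ^+ 2 * D.[sigma j].
  have [_ <-] := eta_value j.
  by rewrite (reval_frac (Dz _ (sigma1 j)) pfrac) mulfVK // Dz.
split.
- split.
  + exact: Blaschke_dataP n_ge1 h sigma1 circle_nodes Dsigma.
  + exact: exists_solution n_ge1 h sigma1 all_nodes circle_nodes Esigma Dsigma.
  + exact: Phi_of_solution n_ge1 h sigma_inj sigma1 R0 circle_nodes Esigma Dsigma.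
- have [tau tau1 tau_n] := circle_infinite [seq sigma j | j <- enum 'I_n].
  have tau_sigma (j : 'I_n) : (j < k)%N -> tau != sigma j.
    by move=> _; apply: contraNneq tau_n => ->; rewrite map_f ?mem_enum.
  have := par_normalised n_ge1 h sigma_inj sigma1 R0 all_nodes circle_nodes
    Esigma Dsigma tau1 tau_sigma.
  by move=> hp; do 4 eexists; exact: hp.
move=> a b c d [sizes [Z _ sol] [tau [tau1 tau_sigma ad bc]] _].
have [-> -> -> ->] := normalised_par n_ge1 h sigma_inj sigma1 R0 all_nodes
  circle_nodes Esigma Dsigma tau1 tau_sigma sizes sol ad bc.
exists (E.[tau] / D.[tau]), ((crev n D).[tau] / D.[tau]).
have := par_conclusion h R0 all_nodes circle_nodes tau1 tau_sigma; exact.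
Qed.
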